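(* Let $T \in \mathcal{B}(\mathcal{H})$. Then for any Orlicz function $\phi$, \[\phi\left(w^2(T)\right) \leq \frac{1}{2}\, \phi\left(\frac12 w^2\left(|T| + i |T^*|\right)\right) + \frac{1}{4}\, \phi\left(w\left(|T||T^*|\right)\right) + \frac{1}{8} \left\|\phi(|T|^2) + \phi(|T^*|^2) \right\|.\]
   Context: $\mathcal{B}(\mathcal{H})$ is the algebra of bounded linear operators on a complex Hilbert space $\mathcal{H}$. For $T\in\mathcal{B}(\mathcal{H})$, $T^*$ is the adjoint, $|T|=(T^*T)^{1/2}$, $|T^*|=(TT^* )^{1/2}$, $\|T\|$ is the operator norm, $w(T)=\sup_{\|x\|=1}|\langle Tx,x\rangle|$ is the numerical radius, and $w^2(T)=(w(T))^2$. Here $i$ is the imaginary unit. For a positive operator $A$, $\phi(A)$ is defined by the continuous functional calculus. An Orlicz function is a continuous, convex, increasing function $\phi:[0,\infty)\to[0,\infty)$ with $\phi(0)=0$, $\phi(t)>0$ for all $t>0$, and $\lim_{t\to\infty}\phi(t)=\infty$. *)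

(* Defs.v *)
From HB Require Import structures.
From mathcomp Require Import all_boot all_order all_algebra.
From mathcomp Require Import complex sesquilinear.
From mathcomp Require Import all_classical all_reals all_analysis.

Set Implicit Arguments.
Unset Strict Implicit.
Unset Printing Implicit Defensive.

Import Order.TTheory GRing.Theory Num.Theory.
Import numFieldNormedType.Exports.

Local Open Scope classical_set_scope.
Local Open Scope ring_scope.
Local Open Scope complex_scope.

(* The inner product is linear in its first argument and conjugate-linear in
   its second. *)
HB.mixin Record CompleteNormedModule_isHilbert (R : realType) H
    of CompleteNormedModule R[i] H := {
  inner : {dot H for @Num.conj R[i]} ;
  sqr_normE : forall x : H, `|x| ^+ 2 = inner x x }.

#[short(type="hilbertType")]
HB.structure Definition Hilbert (R : realType) :=
  {H of CompleteNormedModule_isHilbert R H & CompleteNormedModule R[i] H}.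

Section operators.
Context {R : realType} {H : hilbertType R}.
Implicit Types (A B S T : H -> H) (f : R -> R).

(* Elements of B(H) are plain functions satisfying this predicate; the
   vector-space operations on them are the pointwise ones and their product
   is composition. *)
Definition bounded_operator T : Prop :=
  linear T /\ exists M : R, forall x, `|T x| <= M%:C * `|x|.

(* Norms of vectors and of scalars take their (real) values in R[i], hence the
   projections Re here and in numerical_radius. *)
Definition opnorm T : R :=
  sup [set complex.Re `|T x| | x in [set x : H | `|x| <= 1]].

Definition numerical_radius T : R :=
  sup [set complex.Re `|inner (T x) x| | x in [set x : H | `|x| = 1]].

Definition adjoint T : H -> H :=
  get [set S | bounded_operator S /\
               forall x y, inner (T x) y = inner x (S y)].

Definition spectrum A : set R[i] :=
  [set l | ~ exists B, [/\ bounded_operator B,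
       (A - l *: idfun) \o B = idfun & B \o (A - l *: idfun) = idfun]].

Definition poly_operator (p : {poly R}) A : H -> H :=
  \sum_(k < size p) (p`_k)%:C *: iter k A.

(* Continuous functional calculus f(A) of a self-adjoint A, for f continuous on
   the spectrum (which then consists of reals): the operator-norm limit of
   p_n(A), for polynomials p_n converging to f uniformly on the spectrum.  It
   depends neither on the sequence p_n nor on f off the spectrum. *)
Definition cfc f A : H -> H :=
  get [set B | bounded_operator B /\
    exists p : nat -> {poly R},
      {uniform [set t : R | spectrum A t%:C],
        (fun n t => (p n).[t]) @ \oo --> f} /\
      opnorm (poly_operator (p n) A - B) @[n --> \oo] --> (0 : R)].

Definition absop T : H -> H := cfc Num.sqrt (adjoint T \o T).

End operators.

(* An Orlicz function [0, +oo[ -> [0, +oo[ is represented by a function on R of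
   which only the restriction to [0, +oo[ is constrained. *)
Record orlicz (R : realType) (phi : R -> R) : Prop := {
  orlicz_ge0 : forall t : R, 0 <= t -> 0 <= phi t ;
  orlicz_continuous : {within [set t : R | 0 <= t], continuous phi} ;
  orlicz_convex : forall a s t : R, 0 <= a <= 1 -> 0 <= s -> 0 <= t ->
    phi (a * s + (1 - a) * t) <= a * phi s + (1 - a) * phi t ;
  orlicz_increasing : forall s t : R, 0 <= s -> s <= t -> phi s <= phi t ;
  orlicz0 : phi 0 = 0 ;
  orlicz_gt0 : forall t : R, 0 < t -> 0 < phi t ;
  orlicz_cvgy : phi t @[t --> +oo] --> +oo }.

(* Main.v *)
(* Write P = |T|, Q = |T*| and, for a unit vector x, a = <P x, x>, b = <Q x, x>.
   The mixed Schwarz inequality gives |<T x, x>|^2 <= a b, and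
   a b <= (a^2 + b^2) / 4 + a b / 2, where a^2 + b^2 = |<(P + iQ) x, x>|^2 and,
   by Buzano's inequality, 2 a b <= |P x| |Q x| + <P x, Q x>.  Apply phi, which is
   increasing and convex, bound phi (|P x|^2) and phi (|Q x|^2) by Jensen's
   inequality <phi(A) x, x> >= phi (<A x, x>), and take the supremum over x.

   The functional calculus rests on one fact: for A bounded and self-adjoint, the
   bottom m of the numerical range of p(A) is a value p(t) with t real in the
   spectrum of A.  Indeed p(A) - m is not bounded below; factoring p - m over the
   complex numbers, some A - t is not bounded below either, and t is real because
   A is self-adjoint.  Hence |p(A)| <= sup |p| over the spectrum, and Weierstrass
   approximation gives existence and all needed properties of f(A). *)

Require Import Defs.
From mathcomp Require Import all_boot all_order all_algebra.
From mathcomp Require Import complex sesquilinear.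
From mathcomp Require Import all_classical all_reals all_analysis.
From mathcomp Require Import ring lra.

Import Order.TTheory GRing.Theory Num.Theory.
Import numFieldNormedType.Exports.

Local Open Scope classical_set_scope.
Local Open Scope ring_scope.

Set Implicit Arguments.
Unset Strict Implicit.
Unset Printing Implicit Defensive.

(** * Elementary facts on real numbers *)

Lemma discriminant_le (R : realFieldType) (a b c : R) : 0 <= c ->
  (forall t, 0 <= a + 2 * t * b + t ^+ 2 * c) -> b ^+ 2 <= a * c.
Proof.
rewrite le_eqVlt => /predU1P[<-|c0] h.
  have [->|b0] := eqVneq b 0; first by rewrite expr0n mulr0.
  (* When [c = 0], the affine function of [t] takes the value [- 1] at this point. *)
  have := h (- (a + 1) / (2 * b)); rewrite mulr0 addr0.
  have -> : a + 2 * (- (a + 1) / (2 * b)) * b = - 1 by field.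
  by rewrite oppr_ge0 ler10.
(* For [c > 0] the quadratic is evaluated at its minimiser. *)
have := h (- b / c).
have -> : a + 2 * (- b / c) * b + (- b / c) ^+ 2 * c = (a * c - b ^+ 2) / c.
  by field; rewrite gt_eqF.
by rewrite pmulr_lge0 ?invr_gt0// subr_ge0.
Qed.

Lemma eventually_invS_le (R : realType) (e : R) : 0 < e ->
  exists N, forall n : nat, (N <= n)%N -> n.+1%:R^-1 <= e.
Proof.
move=> e0; exists (Num.truncn e^-1) => n hn.
rewrite -[e]invrK lef_pV2 ?posrE ?invr_gt0//.
by rewrite (le_trans (ltW (truncnS_gt _)))// ler_nat ltnS.
Qed.

(** * The Hilbert space with its real inner product *)

Section real_inner.
Context {R : realType} {H : hilbertType R}.
Implicit Types (x y z : H).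

(** The real part of [inner] makes [H] a real inner product space, so that estimates take place in
    [R]; [innerE] recovers the complex product from [rin] and multiplication by [i]. *)
Definition rin x y : R := complex.Re (inner x y).
Definition nrm x : R := complex.Re `|x|.

Lemma innerC x y : inner x y = (inner y x)^*.
Proof. by rewrite (hermC (inner : {dot H for @Num.conj R[i]})) expr0 mul1r. Qed.

Lemma rinC x y : rin x y = rin y x.
Proof. by rewrite /rin innerC; case: (inner y x). Qed.

Lemma rinDl x y z : rin (x + y) z = rin x z + rin y z.
Proof. by rewrite /rin linearDl /=; case: (inner x z) => a b; case: (inner y z). Qed.

Lemma rinZl (a : R) x y : rin (a%:C%C *: x) y = a * rin x y.
Proof. by rewrite /rin linearZl_LR /=; case: (inner x y) => u v /=; rewrite mul0r subr0. Qed.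

Lemma nrmE x : `|x| = (nrm x)%:C%C.
Proof. by rewrite /nrm RRe_real// ger0_real. Qed.

Lemma nrm_ge0 x : 0 <= nrm x.
Proof. by rewrite -ler0c -nrmE. Qed.

Lemma nrm_sqr x : nrm x ^+ 2 = rin x x.
Proof. by rewrite /rin -sqr_normE nrmE -rmorphXn. Qed.

Lemma Im_inner x y : complex.Im (inner x y) = rin x ('i%C *: y).
Proof. by rewrite /rin linearZr_LR /=; case: (inner x y) => u v /=; rewrite !mul0r; ring. Qed.

Lemma rin_i x y : rin ('i%C *: x) ('i%C *: y) = rin x y.
Proof. by rewrite /rin linearZl_LR linearZr_LR /=; case: (inner x y) => u v /=; ring. Qed.


Lemma rinDr x y z : rin x (y + z) = rin x y + rin x z.
Proof. by rewrite rinC rinDl !(rinC x). Qed.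

Lemma rinZr (a : R) x y : rin x (a%:C%C *: y) = a * rin x y.
Proof. by rewrite rinC rinZl rinC. Qed.

Lemma rinNl x y : rin (- x) y = - rin x y.
Proof. by rewrite -mulN1r -rinZl rmorphN1 scaleN1r. Qed.

Lemma rinNr x y : rin x (- y) = - rin x y.
Proof. by rewrite rinC rinNl rinC. Qed.

Lemma rinBl x y z : rin (x - y) z = rin x z - rin y z.
Proof. by rewrite rinDl rinNl. Qed.

Lemma rinBr x y z : rin x (y - z) = rin x y - rin x z.
Proof. by rewrite rinDr rinNr. Qed.

Lemma rin0l x : rin 0 x = 0.
Proof. by rewrite -(subrr 0) rinBl subrr. Qed.

Lemma rin0r x : rin x 0 = 0.
Proof. by rewrite rinC rin0l. Qed.

Definition rinE := (rinDl, rinDr, rinBl, rinBr, rinNl, rinNr, rinZl, rinZr).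

Lemma rin_ge0 x : 0 <= rin x x.
Proof. by rewrite -nrm_sqr sqr_ge0. Qed.

Lemma nrm_eq0 x : (nrm x == 0) = (x == 0).
Proof. by rewrite -(inj_eq (@complexI R)) -nrmE normr_eq0. Qed.

Lemma nrm0 : nrm (0 : H) = 0.
Proof. by apply/eqP; rewrite nrm_eq0. Qed.

Lemma rin_eq0 x : (rin x x == 0) = (x == 0).
Proof. by rewrite -nrm_sqr sqrf_eq0 nrm_eq0. Qed.

Lemma rin_ext x y : (forall z, rin x z = rin y z) -> x = y.
Proof.
by move=> h; apply/eqP; rewrite -subr_eq0 -rin_eq0 rinBl h subrr.
Qed.

Lemma innerE x y : inner x y = Complex (rin x y) (rin x ('i%C *: y)).
Proof. by rewrite -Im_inner /rin; case: (inner x y). Qed.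

Lemma ler_nrmD x y : nrm (x + y) <= nrm x + nrm y.
Proof. by rewrite -lecR rmorphD /= -!nrmE ler_normD. Qed.

Lemma nrmN x : nrm (- x) = nrm x.
Proof. by rewrite /nrm normrN. Qed.

Lemma nrmB x y : nrm (x - y) = nrm (y - x).
Proof. by rewrite /nrm distrC. Qed.

Lemma ler_nrmB x y z : nrm (x - z) <= nrm (x - y) + nrm (y - z).
Proof. by rewrite (le_trans _ (ler_nrmD _ _))// addrA subrK. Qed.

Lemma nrmZ (a : R[i]) x : nrm (a *: x) = complex.Re `|a| * nrm x.
Proof.
by rewrite /nrm normrZ nrmE -(RRe_real (normr_real a)) -rmorphM.
Qed.

Lemma nrmZr (a : R) x : nrm (a%:C%C *: x) = `|a| * nrm x.
Proof. by rewrite nrmZ normc_def /= expr0n addr0 sqrtr_sqr. Qed.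

Lemma nrm_i x : nrm ('i%C *: x) = nrm x.
Proof. by rewrite nrmZ normc_def /= expr0n add0r expr1n sqrtr1 mul1r. Qed.

(** For a complex-linear [A] this amounts to self-adjointness for [inner], by [innerE]. *)
Definition rsym (A : H -> H) := forall x y, rin (A x) y = rin x (A y).

(** Discriminant of the nonnegative quadratic [t -> <A (t y + x), t y + x>]; the form may be
    degenerate. *)
Lemma positive_form_CS (A : H -> H) x y : linear A -> rsym A ->
  (forall z, 0 <= rin (A z) z) -> rin (A x) y ^+ 2 <= rin (A x) x * rin (A y) y.
Proof.
move=> linA symA posA; apply: discriminant_le => // t.
have := posA (t%:C%C *: y + x); rewrite linA !rinE (symA y x) (rinC y).
by congr (0 <= _); ring.
Qed.

Lemma rin_CS x y : `|rin x y| <= nrm x * nrm y.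
Proof.
rewrite -ler_sqr ?nnegrE ?mulr_ge0 ?nrm_ge0// exprMn !nrm_sqr.
rewrite real_normK ?num_real//.
by apply: (@positive_form_CS idfun) => // z; exact: rin_ge0.
Qed.

Lemma rin_le x y : rin x y <= nrm x * nrm y.
Proof. exact: le_trans (ler_norm _) (rin_CS _ _). Qed.

Definition rbounded (A : H -> H) (M : R) := forall x, nrm (A x) <= M * nrm x.

Lemma bounded_operatorP (T : H -> H) :
  bounded_operator T <-> linear T /\ exists M, 0 < M /\ rbounded T M.
Proof.
split=> -[linT [M hM]]; split=> //.
  exists (`|M| + 1); split=> [|x]; first by rewrite ltr_wpDl.
  have := hM x; rewrite !nrmE -rmorphM lecR => /le_trans; apply.
  by rewrite ler_wpM2r ?nrm_ge0// (le_trans (ler_norm _)) ?lerDl.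
exists M => x; rewrite !nrmE -rmorphM lecR; exact: hM.2.
Qed.

Lemma lin0 (A : H -> H) : linear A -> A 0 = 0.
Proof. by move=> /(_ (-1) 0 0); rewrite scaler0 add0r scaleN1r addNr. Qed.

Lemma linD (A : H -> H) x y : linear A -> A (x + y) = A x + A y.
Proof. by move=> /(_ 1 x y); rewrite !scale1r. Qed.

Lemma linZ (A : H -> H) a x : linear A -> A (a *: x) = a *: A x.
Proof. by move=> linA; have := linA a x 0; rewrite !addr0 (lin0 linA) addr0. Qed.

Lemma linB (A : H -> H) x y : linear A -> A (x - y) = A x - A y.
Proof. by move=> linA; rewrite linD// -scaleN1r linZ// scaleN1r. Qed.

End real_inner.

(** * Weierstrass approximation by Bernstein polynomials *)

Section bernstein.
Context {R : realType}.
Implicit Types (u c a d : R) (g h : nat -> R) (f : R -> R).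

(** De Casteljau's recursion for the sum over [k] of [C(n,k) g(k) X^k (1 - X)^(n - k)]. Its value at
    [u] is the mean of [g(k)] when [k] counts successes in [n] trials of probability [u]. *)
Fixpoint bernstein n g : {poly R} :=
  if n is m.+1 then 'X * bernstein m (g \o S) + (1 - 'X) * bernstein m g
  else (g 0%N)%:P.

Lemma bernsteinS n g u : (bernstein n.+1 g).[u] =
  u * (bernstein n (g \o S)).[u] + (1 - u) * (bernstein n g).[u].
Proof. by rewrite /= !hornerE. Qed.

Lemma bernstein_le n g h u : 0 <= u <= 1 ->
  (forall k, (k <= n)%N -> g k <= h k) ->
  (bernstein n g).[u] <= (bernstein n h).[u].
Proof.
move=> /andP[u0 u1]; elim: n g h => [|n IH] g h gh; first by rewrite !hornerE gh.
rewrite !bernsteinS lerD// ler_wpM2l ?subr_ge0//; apply: IH => k kn; apply: gh => //.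
exact: leqW.
Qed.

(** Mean and variance of the binomial law: the expected squared distance to [d] is the variance
    [n u (1 - u)] plus the squared bias. *)
Lemma bernstein_quadratic n c a d u :
  (bernstein n (fun k => c + a * (k%:R - d) ^+ 2)).[u] =
  c + a * (n%:R * u * (1 - u) + (n%:R * u - d) ^+ 2).
Proof.
elim: n d => [|n IH] d; first by rewrite /= !hornerE; ring.
rewrite bernsteinS IH.
have -> : (fun k => c + a * (k%:R - d) ^+ 2) \o S =
    (fun k => c + a * (k%:R - (d - 1)) ^+ 2).
  by apply/funext => k /=; rewrite -natr1; ring.
by rewrite IH -natr1; ring.
Qed.

Lemma within_continuousP (K : set R) f : {within K, continuous f} ->
  forall x e, K x -> 0 < e ->
  exists2 d : R, 0 < d & forall y : R, K y -> `|x - y| < d -> `|f x - f y| <= e.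
Proof.
move=> /subspace_continuousP cf x e Kx e0.
have /cvgrPdist_le/(_ e e0) := cf x Kx.
by move=> /nbhs_ballP[d d0 hd]; exists d => // y Ky xy; apply: hd.
Qed.

(** Heine-Cantor, by compactness of the segment in its near-covering form; the parameter is the
    modulus, tending to [0] from the right. *)
Lemma within_continuous_uniform f (M e : R) : 0 < e ->
  {within `[0, M], continuous f} -> exists2 d : R, 0 < d & forall s t : R,
    0 <= s <= M -> 0 <= t <= M -> `|s - t| < d -> `|f s - f t| <= e.
Proof.
move=> e0 cf.
have := @segment_compact R 0 M; rewrite compact_near_coveringP => /near_covering_withinP.
move=> /(_ R (0^'+) (fun d t => forall s, s \in `[0, M] -> `|s - t| < d ->
  `|f s - f t| <= e) _).
case.
  move=> t tM; have [d d0 hd] := within_continuousP cf tM (divr_gt0 e0 (ltr0n _ 2)).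
  have d20 : 0 < d / 2 by rewrite divr_gt0.
  (* Half radii keep both points within [d] of the centre [t]. *)
  exists (ball t (d / 2), [set r | r < d / 2]) => [|[y r] /= [ty rd] yM s sM sy].
    by split => /=; [exact: nbhsx_ballx|exact: nbhs_right_lt].
  rewrite (splitr e) (le_trans (ler_distD (f t) _ _))// lerD//.
    rewrite distrC; apply: hd => //; rewrite (splitr d).
    rewrite (le_lt_trans (ler_distD y _ _))// ltrD// distrC.
    exact: lt_trans sy rd.
  by apply: hd => //; rewrite (lt_trans ty)// ltr_pdivrMr// mulr_natr mulr2n ltrDl.
move=> d /= d0 hd; exists (d / 2); first by rewrite divr_gt0.
move=> s t sM tM st; apply: (hd (d / 2)) => //=.
- by rewrite sub0r normrN gtr0_norm ?divr_gt0// ltr_pdivrMr// mulr_natr mulr2n ltrDl.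
- by rewrite divr_gt0.
Qed.

(** Bernstein's argument: [f s] differs from [f t] by at most [e / 2] plus a multiple of
    [(s - t) ^+ 2]; averaging over the binomial law turns the square into a variance, which is
    [O(1/n)] after rescaling to [[0, M]]. *)
Lemma weierstrass f (M e : R) : 0 < M -> 0 < e ->
  {within `[0, M], continuous f} ->
  exists p : {poly R}, forall t : R, 0 <= t <= M -> `|p.[t] - f t| <= e.
Proof.
move=> M0 e0 cf.
have [|d d0 hd] := @within_continuous_uniform f M (e / 2) _ cf.
  by rewrite divr_gt0.
have [a _ ha] := EVT_max (ltW M0) cf; have [b _ hb] := EVT_min (ltW M0) cf.
pose C := f a - f b.
have fC (s t : R) : 0 <= s <= M -> 0 <= t <= M -> `|f s - f t| <= C.
  move=> sM tM; rewrite ler_norml /C.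
  have := ha s; have := ha t; have := hb s; have := hb t; rewrite !in_itv /=.
  move=> /(_ tM) ? /(_ sM) ? /(_ tM) ? /(_ sM) ?; lra.
have C0 : 0 <= C by rewrite (le_trans (normr_ge0 _) (fC 0 0 _ _))// lexx ltW.
(* At distance at least [d], the oscillation [C] is absorbed by [((s - t) / d) ^+ 2 >= 1]. *)
have key (s t : R) : 0 <= s <= M -> 0 <= t <= M ->
    `|f s - f t| <= e / 2 + C / d ^+ 2 * (s - t) ^+ 2.
  move=> sM tM; have [st|st] := ltP `|s - t| d.
    by rewrite (le_trans (hd _ _ sM tM st))// lerDl mulr_ge0 ?sqr_ge0 ?divr_ge0 ?sqr_ge0.
  rewrite (le_trans (fC _ _ sM tM))// (@le_trans _ _ (C / d ^+ 2 * (s - t) ^+ 2))//.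
    rewrite mulrAC ler_pdivlMr ?exprn_gt0// ler_wpM2l//.
    by rewrite -(real_normK (num_real (s - t))) lerXn2r// nnegrE ltW.
  by rewrite lerDr divr_ge0 ?ltW.
(* This [n] makes [C M^2 / (d^2 n)] at most [e]; with [u (1 - u) <= 1/2] the averaged quadratic term
   is at most [e / 2]. *)
have [n [n0 hn]] : exists n : nat, 0 < n%:R :> R /\ C * M ^+ 2 / d ^+ 2 / e < n%:R.
  by exists (Num.truncn (C * M ^+ 2 / d ^+ 2 / e)).+1; rewrite ltr0n truncnS_gt.
exists (bernstein n (fun k => f (M * k%:R / n%:R)) \Po (M^-1 *: 'X)) => t tM.
rewrite horner_comp hornerZ hornerX.
set u := M^-1 * t.
have u01 : 0 <= u <= 1.
  by case/andP: tM => t0 tM; rewrite /u mulrC ler_pdivrMr// mul1r tM divr_ge0// ltW.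
have tE : t = M * u by rewrite /u mulrA divff ?mul1r// gt_eqF.
pose A := C / d ^+ 2 * (M / n%:R) ^+ 2.
have A0 : 0 <= A by rewrite mulr_ge0 ?sqr_ge0 ?divr_ge0 ?sqr_ge0.
have An : A * (n%:R * u * (1 - u)) <= e / 2.
  have uu : u * (1 - u) <= 2^-1.
    have : 0 <= (u - 2^-1) ^+ 2 by exact: sqr_ge0.
    have := u01; nra.
  have -> : A * (n%:R * u * (1 - u)) = C * M ^+ 2 / d ^+ 2 / n%:R * (u * (1 - u)).
    by rewrite /A; field; rewrite !gt_eqF.
  rewrite ler_pM//.
  - by rewrite divr_ge0 ?(ltW n0)// divr_ge0 ?sqr_ge0// mulr_ge0 ?sqr_ge0.
  - by case/andP: u01 => u0 u1; rewrite mulr_ge0// subr_ge0.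
  by move: hn; rewrite ltr_pdivrMr// => /ltW; rewrite (ler_pdivrMr _ _ n0) (mulrC e).
have kn (k : nat) : (k <= n)%N -> 0 <= M * k%:R / n%:R <= M.
  move=> kn; rewrite divr_ge0 ?mulr_ge0 ?(ltW M0) ?(ltW n0)//= ler_pdivrMr//.
  by rewrite ler_wpM2l ?(ltW M0)// ler_nat.
have q (k : nat) : (M * k%:R / n%:R - t) ^+ 2 = (M / n%:R) ^+ 2 * (k%:R - n%:R * u) ^+ 2.
  by rewrite tE; field; rewrite gt_eqF.
have hk k : (k <= n)%N -> `|f (M * k%:R / n%:R) - f t| <=
    e / 2 + A * (k%:R - n%:R * u) ^+ 2.
  by move=> /kn kM; rewrite (le_trans (key _ _ kM tM))// q mulrA.
(* Centring at the mean [n u] makes the bias vanish. *)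
have quad c a := bernstein_quadratic n c a (n%:R * u) u.
rewrite ler_distl; apply/andP; split.
  apply: (@le_trans _ _ (bernstein n (fun k => (f t - e / 2) + - A * (k%:R - n%:R * u) ^+ 2)).[u]).
    by rewrite quad subrr expr0n addr0; lra.
  by apply: bernstein_le => // k /hk; rewrite ler_distl => /andP[+ _]; lra.
apply: (@le_trans _ _ (bernstein n (fun k => (f t + e / 2) + A * (k%:R - n%:R * u) ^+ 2)).[u]).
  by apply: bernstein_le => // k /hk; rewrite ler_distl => /andP[_]; lra.
by rewrite quad subrr expr0n addr0; lra.
Qed.

End bernstein.

(** * Completeness, Riesz representation and existence of adjoints *)

Section completeness.
Context {R : realType} {H : hilbertType R}.
Implicit Types (x y z : H) (A B S T : H -> H).

Lemma nrm_cauchy_cvg (u : nat -> H) :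
  (forall e : R, 0 < e -> exists N, forall m n, (N <= m)%N -> (N <= n)%N ->
    nrm (u m - u n) <= e) ->
  exists l, forall e : R, 0 < e -> exists N, forall n, (N <= n)%N ->
    nrm (u n - l) <= e.
Proof.
move=> cu; have /cauchy_cvg ucvg : cauchy (u @ \oo).
  apply/cauchy_exP => e e0; have eE : e = (complex.Re e)%:C%C.
    by rewrite RRe_real// gtr0_real.
  move: e0; rewrite {1}eE -[0]/(0%:C%C) ltcR => e0.
  have [N hN] := cu _ (divr_gt0 e0 (ltr0n _ 2)).
  exists (u N); exists N => // n /= Nn.
  rewrite -ball_normE /= eE nrmE ltcR (le_lt_trans (hN _ _ _ Nn))//.
  by rewrite ltr_pdivrMr// mulr_natr mulr2n ltrDl.
exists (lim (u @ \oo)) => e e0.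
have /cvgrPdist_le/(_ e%:C%C) : u @ \oo --> lim (u @ \oo) by [].
rewrite -[0]/(0%:C%C) ltcR => /(_ e0)[N _ hN]; exists N => n Nn.
by have := hN n Nn; rewrite nrmE lecR nrmB.
Qed.

Lemma rin_conj (a : R[i]) x y : rin x (a *: y) = rin ((a^*)%C *: x) y.
Proof. by rewrite /rin linearZr_LR linearZl_LR. Qed.

(** The vector [u] minimises [J x = <B x, x> - 2 f x]; coercivity makes minimising sequences Cauchy.
    [B = idfun] is Riesz's theorem, and a general [B] yields inverses of coercive operators. *)
Lemma coercive_riesz B (f : H -> R) (c K L : R) : linear B -> rsym B ->
  rbounded B K -> 0 < c -> (forall x, c * rin x x <= rin (B x) x) ->
  (forall (a : R) x y, f (a%:C%C *: x + y) = a * f x + f y) ->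
  (forall x, `|f x| <= L * nrm x) ->
  exists u, forall x, f x = rin (B u) x.
Proof.
move=> linB symB bB c0 coB linf bf.
pose J x := rin (B x) x - 2 * f x.
have JD x y (t : R) : J (t%:C%C *: y + x) =
    J x + 2 * t * (rin (B x) y - f y) + t ^+ 2 * rin (B y) y.
  by rewrite /J linf linB !rinE (symB y x) (rinC y); ring.
have Jlb : has_lbound (range J).
  exists (- (L ^+ 2 / c)) => _ [x _ <-].
  rewrite lerNl ler_pdivlMr//.
  have := coB x; have := le_trans (ler_norm _) (bf x); rewrite /J -nrm_sqr => h1 h2.
  have := ler_wpM2l (ltW c0) h2; have := ler_wpM2l (ltW c0) h1.
  have := sqr_ge0 (c * nrm x - L); lra.
have Jinf : has_inf (range J) by split => //; exists (J 0), 0.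
pose m := inf (range J).
have mJ x : m <= J x by apply: ge_inf => //; exists x.
have /choice[u hu] n : exists x, J x < m + n.+1%:R^-1.
  have n0 : 0 < n.+1%:R^-1 :> R by rewrite invr_gt0.
  by have [_ [x _ <-] hx] := inf_adherent n0 Jinf; exists x.
(* Parallelogram identity: with [z] half of [x - y] and [x - z] the midpoint, [J x + J y] is
   [2 J (x - z) + 2 <B z, z>]. *)
have par x y : c / 2 * nrm (x - y) ^+ 2 <= J x + J y - 2 * m.
  have -> : x - y = 2%:C%C *: (2^-1%:C%C *: (x - y)).
    by rewrite scalerA -rmorphM divff// rmorph1 scale1r.
  set z := _ *: (x - y).
  have hx : x = 1%:C%C *: z + (x - z) by rewrite rmorph1 scale1r addrC subrK.
  have hy : y = (-1)%:C%C *: z + (x - z).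
    rewrite rmorphN1 scaleN1r addrCA -opprD -mulr2n /z.
    rewrite -scaler_nat scalerA.
    have -> : 2%:R * 2^-1%:C%C = 1 :> R[i].
      by rewrite fmorphV rmorph_nat divff// pnatr_eq0.
    by rewrite scale1r opprB addrC subrK.
  have := JD (x - z) z 1; have := JD (x - z) z (-1); rewrite -hx -hy => -> ->.
  have := mJ (x - z); have := coB z.
  rewrite nrmZr exprMn nrm_sqr gtr0_norm//.
  lra.
have [l hl] : exists l, forall e : R, 0 < e -> exists N, forall n, (N <= n)%N ->
    nrm (u n - l) <= e.
  apply: nrm_cauchy_cvg => e e0.
  have [|N hN] := @eventually_invS_le R (c / 4 * e ^+ 2).
    by rewrite mulr_gt0 ?exprn_gt0// divr_gt0.
  exists N => p q Np Nq.
  rewrite -ler_sqr ?nnegrE ?nrm_ge0 ?(ltW e0)//.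
  have c2 : 0 < c / 2 by rewrite divr_gt0.
  rewrite -(ler_pM2l c2) (le_trans (par _ _))//.
  move: (hu p) (hu q) (hN _ Np) (hN _ Nq).
  by move: (p.+1%:R^-1) (q.+1%:R^-1) => ip iq; lra.
have Jl : J l <= m.
  apply/ler_addgt0Pr => e e0.
  pose D := 2 * (`|K| * nrm l + `|L|) + 1.
  have D0 : 0 < D by rewrite ltr_wpDl// mulr_ge0// addr_ge0// mulr_ge0 ?nrm_ge0.
  have e2 : 0 < e / 2 by rewrite divr_gt0.
  have [N1 h1] := eventually_invS_le e2; have [N2 h2] := hl _ (divr_gt0 e2 D0).
  pose n := maxn N1 N2.
  have := JD l (u n - l) 1; rewrite rmorph1 scale1r subrK => q4.
  move: (h1 n (leq_maxl _ _)) (h2 n (leq_maxr _ _)) (hu n).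
  move: (n.+1%:R^-1) => i.
  set h := u n - l => q1; rewrite ler_pdivlMr// => q2 q3.
  rewrite -/h in q4.
  have q5 := le_trans (mulr_ge0 (ltW c0) (rin_ge0 h)) (coB h).
  have q6 := bf h; have q7 := rin_CS (B l) h.
  have q8 := ler_wpM2r (nrm_ge0 h) (bB l).
  have q9 : K * nrm l * nrm h <= `|K| * nrm l * nrm h.
    by rewrite !ler_wpM2r ?nrm_ge0// ler_norm.
  have q10 : L * nrm h <= `|L| * nrm h by rewrite ler_wpM2r ?nrm_ge0// ler_norm.
  move: q6 q7; rewrite !ler_norml => /andP[_ q6] /andP[q7 _].
  have q11 : 0 <= nrm h := nrm_ge0 h.
  move: q2; rewrite /D; lra.
(* At the minimum, [J (t x + l) - J l] is a nonnegative quadratic in [t] without constant term, so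
   its linear coefficient vanishes. *)
exists l => x; apply/eqP; rewrite eq_sym -subr_eq0 -sqrf_eq0 eq_le sqr_ge0 andbT.
rewrite -[leRHS](mul0r (rin (B x) x)); apply: discriminant_le.
  exact: le_trans (mulr_ge0 (ltW c0) (rin_ge0 x)) (coB x).
by move=> t; have := JD l x t; have := mJ (t%:C%C *: x + l); move: Jl; lra.
Qed.

(** [S y] is the Riesz vector of the real functional [x -> Re <T x, y>]. Complex linearity of [S]
    follows by moving scalars across as conjugates, and [innerE] then upgrades the real identity to
    the complex one. *)
Lemma adjoint_exists T : bounded_operator T ->
  exists S, bounded_operator S /\ forall x y, inner (T x) y = inner x (S y).
Proof.
move=> /bounded_operatorP[linT [M [M0 bT]]].
have /choice[S hS] y : exists u, forall x, rin (T x) y = rin x u.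
  have [|||||||u hu] := @coercive_riesz idfun (fun x => rin (T x) y) 1 1 (M * nrm y) => //.
  - by move=> x; rewrite mul1r.
  - by move=> x; rewrite mul1r.
  - by move=> a x z; rewrite linT !rinE.
  - move=> x; rewrite (le_trans (rin_CS _ _))// mulrAC ler_wpM2r ?nrm_ge0//.
  by exists u => x; rewrite hu rinC.
have linS : linear S.
  move=> a x y; apply: rin_ext => z; rewrite rinC -hS rinDr rin_conj.
  by rewrite -(linZ _ _ linT) !hS (rinC _ z) rinDr rin_conj.
exists S; split.
  apply/bounded_operatorP; split=> //; exists M; split=> // y.
  have [->|S0] := eqVneq (nrm (S y)) 0; first by rewrite mulr_ge0 ?nrm_ge0 ?ltW.
  have S1 : 0 < nrm (S y) by rewrite lt_def S0 nrm_ge0.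
  (* The chain is [|S y|^2 = <T (S y), y> <= M |S y| |y|]. *)
  rewrite -(ler_pM2l S1) -expr2 nrm_sqr -hS (le_trans (rin_le _ _))//.
  by rewrite mulrCA mulrA ler_wpM2r ?nrm_ge0.
by move=> x y; rewrite !innerE -(linZ _ _ linS) !hS.
Qed.

Lemma adjointP T : bounded_operator T ->
  bounded_operator (adjoint T) /\ forall x y, rin (T x) y = rin x (adjoint T y).
Proof.
move=> /adjoint_exists/getPex; rewrite -/(adjoint T) => -[bS hS].
by split=> // x y; rewrite /rin hS.
Qed.

End completeness.

(** * Polynomials of operators and the spectrum *)

Section polynomials_of_operators.
Context {R : realType} {H : hilbertType R}.
Implicit Types (x y z : H) (A B S T : H -> H).

(** Complex coefficients are allowed because real polynomials will be split into linear factors over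
    the complex numbers. *)
Definition cpop (p : {poly R[i]}) A x : H := \sum_(k < size p) p`_k *: iter k A x.

Lemma cpop_wide n (p : {poly R[i]}) A x : (size p <= n)%N ->
  cpop p A x = \sum_(k < n) p`_k *: iter k A x.
Proof.
move=> pn; rewrite /cpop (big_ord_widen _ (fun k => p`_k *: iter k A x) pn).
rewrite big_mkcond; apply: eq_bigr => k _; case: ltnP => // kp.
by rewrite nth_default// scale0r.
Qed.

(** Horner's rule, on which the inductions over polynomials rest. *)
Lemma cpop_cons p c A x : cpop (p * 'X + c%:P) A x = cpop p A (A x) + c *: x.
Proof.
have sz : (size (p * 'X + c%:P)%R <= (size p).+1)%N.
  by rewrite size_MXaddC; case: ifP.
rewrite (cpop_wide _ _ sz) big_ord_recl addrC; congr (_ + _); last first.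
  by rewrite coefD coefMX coefC /= add0r.
apply: eq_bigr => k _; rewrite coefD coefMX coefC /= addr0.
by rewrite -[iter _ A (A x)]iterSr.
Qed.

Lemma cpop0 A x : cpop 0 A x = 0.
Proof. by rewrite /cpop size_poly0 big_ord0. Qed.

Lemma cpopC c A x : cpop c%:P A x = c *: x.
Proof. by have := cpop_cons 0 c A x; rewrite mul0r add0r cpop0 add0r. Qed.

Lemma cpopD p q A x : cpop (p + q) A x = cpop p A x + cpop q A x.
Proof.
elim/poly_ind: p q x => [|p c IH] q x; first by rewrite cpop0 !add0r.
elim/poly_ind: q => [|q d _]; first by rewrite cpop0 !addr0.
by rewrite addrACA -mulrDl -polyCD !cpop_cons IH scalerDl addrACA.
Qed.

Lemma cpop_linear p A : linear A -> linear (cpop p A).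
Proof.
move=> linA; elim/poly_ind: p => [|p c IH] a x y.
  by rewrite !cpop0 scaler0 addr0.
by rewrite !cpop_cons linA IH !scalerDr !scalerA mulrC addrACA.
Qed.

Lemma cpop_comm p A x : linear A -> cpop p A (A x) = A (cpop p A x).
Proof.
move=> linA; elim/poly_ind: p x => [|p c IH] x; first by rewrite !cpop0 (lin0 linA).
by rewrite !cpop_cons IH (linD _ _ linA) (linZ _ _ linA).
Qed.

Lemma cpopZ c p A x : cpop (c *: p) A x = c *: cpop p A x.
Proof.
elim/poly_ind: p x => [|p d IH] x; first by rewrite scaler0 !cpop0 scaler0.
have -> : c *: (p * 'X + d%:P) = (c *: p) * 'X + (c * d)%:P.
  by rewrite scalerDr scalerAl polyCM mul_polyC.
by rewrite !cpop_cons IH scalerDr scalerA.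
Qed.

Lemma cpopM p q A x : linear A -> cpop (p * q) A x = cpop p A (cpop q A x).
Proof.
move=> linA; elim/poly_ind: p q x => [|p c IH] q x; first by rewrite mul0r !cpop0.
rewrite mulrDl -mulrA ['X * q]mulrC mulrA cpopD mul_polyC cpopZ.
rewrite -[_ * 'X]addr0 !cpop_cons scale0r addr0 IH.
by rewrite -(cpop_comm _ _ linA).
Qed.

Definition rpop (p : {poly R}) A := cpop (map_poly (real_complex R) p) A.

Lemma poly_operatorE p A : poly_operator p A = rpop p A.
Proof.
apply/funext => x; rewrite /poly_operator fct_sumE /rpop /cpop size_map_poly.
by apply: eq_bigr => k _; rewrite coef_map.
Qed.

Lemma rpop_cons p c A x : rpop (p * 'X + c%:P) A x = rpop p A (A x) + c%:C%C *: x.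
Proof. by rewrite /rpop rmorphD rmorphM /= map_polyX map_polyC cpop_cons. Qed.

Lemma rpopC c A x : rpop c%:P A x = c%:C%C *: x.
Proof. by rewrite /rpop map_polyC cpopC. Qed.

Lemma rpopD p q A x : rpop (p + q) A x = rpop p A x + rpop q A x.
Proof. by rewrite /rpop rmorphD cpopD. Qed.

Lemma rpopZ c p A x : rpop (c *: p) A x = c%:C%C *: rpop p A x.
Proof. by rewrite /rpop map_polyZ cpopZ. Qed.

Lemma rpopB p q A x : rpop (p - q) A x = rpop p A x - rpop q A x.
Proof. by rewrite -scaleN1r rpopD rpopZ rmorphN1 scaleN1r. Qed.

Lemma rpopM p q A x : linear A -> rpop (p * q) A x = rpop p A (rpop q A x).
Proof. by move=> linA; rewrite /rpop rmorphM /= cpopM. Qed.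

Lemma rpopX A x : rpop 'X A x = A x.
Proof.
have := rpop_cons 1 0 A x; rewrite mul1r addr0 => ->.
by rewrite -polyC1 rpopC rmorph1 scale1r scale0r addr0.
Qed.

Lemma rpop_linear p A : linear A -> linear (rpop p A).
Proof. exact: cpop_linear. Qed.

Lemma rpop_sym p A : linear A -> rsym A -> rsym (rpop p A).
Proof.
move=> linA symA; elim/poly_ind: p => [|p c IH] x y.
  by rewrite /rpop rmorph0 !cpop0 rin0l rin0r.
by rewrite !rpop_cons !rinE IH symA /rpop (cpop_comm _ _ linA).
Qed.

Lemma rpop_bounded p A : bounded_operator A -> bounded_operator (rpop p A).
Proof.
move=> /bounded_operatorP[linA [M [M0 bA]]]; apply/bounded_operatorP.
split; first exact: rpop_linear.
suff [K hK] : exists K, rbounded (rpop p A) K.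
  exists (`|K| + 1); split; first by rewrite ltr_wpDl.
  move=> x; rewrite (le_trans (hK x))// ler_wpM2r ?nrm_ge0//.
  by rewrite (le_trans (ler_norm K))// lerDl.
elim/poly_ind: p => [|p c [K hK]].
  by exists 0 => x; rewrite /rpop rmorph0 cpop0 nrm0 mul0r.
exists (`|K| * M + `|c|) => x; rewrite rpop_cons (le_trans (ler_nrmD _ _))//.
rewrite mulrDl nrmZr lerD// (le_trans (hK _))//.
apply: (@le_trans _ _ (`|K| * nrm (A x))).
  by rewrite ler_wpM2r ?nrm_ge0// ler_norm.
by rewrite -mulrA ler_wpM2l.
Qed.

(** For a linear [A], the negation says that [0] is an approximate eigenvalue. *)
Definition bounded_below A := exists c : R, 0 < c /\ forall x, c * nrm x <= nrm (A x).

(** By contraposition: a product of operators that are bounded below is bounded below, and the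
    leading coefficient is a nonzero scalar. *)
Lemma bounded_below_root (p : {poly R[i]}) A : linear A -> p != 0 ->
  ~ bounded_below (cpop p A) ->
  exists z : R[i], root p z /\ ~ bounded_below (fun x => A x - z *: x).
Proof.
move=> linA p0; have [r pE] := closed_field_poly_normal p.
have nlc : 0 < complex.Re `|lead_coef p|.
  by rewrite -ltcR RRe_real ?normr_real// normr_gt0 lead_coef_eq0.
apply: contra_notP => /forallNP hr.
suff [c [c0 hc]] : bounded_below (cpop (\prod_(z <- r) ('X - z%:P)) A).
  exists (complex.Re `|lead_coef p| * c); split; first by rewrite mulr_gt0.
  by move=> x; rewrite [in leRHS]pE cpopZ nrmZ -mulrA ler_wpM2l// ltW.
have : forall z : R[i], z \in r -> bounded_below (fun x => A x - z *: x).
  move=> z zr; apply: contrapT => nz; apply: (hr z); split=> //.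
  by rewrite pE rootZ ?lead_coef_eq0// root_prod_XsubC.
elim: r {pE hr} => [|z r IH] hr.
  exists 1; split => // x; rewrite big_nil -polyC1 cpopC scale1r.
  by rewrite mul1r.
have [|c [c0 hc]] := IH.
  by move=> y yr; apply: hr; rewrite inE yr orbT.
have [d [d0 hd]] := hr z (mem_head _ _).
exists (d * c); split; first by rewrite mulr_gt0.
move=> x; rewrite big_cons (cpopM _ _ _ linA) -mulrA.
set y := cpop _ A x; have -> : cpop ('X - z%:P) A y = A y - z *: y.
  rewrite -polyCN -['X]mul1r cpop_cons -polyC1 cpopC scale1r scaleNr //.
by rewrite (le_trans _ (hd y))// ler_wpM2l// ltW.
Qed.

(** This is the imaginary part of [<A x, x>], which symmetry makes equal to its own opposite. *)
Lemma rin_rsym_i A x : linear A -> rsym A -> rin (A x) ('i%C *: x) = 0.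
Proof.
move=> linA symA; have h : rin (A x) ('i%C *: x) = - rin (A x) ('i%C *: x).
  rewrite {1}symA (linZ _ _ linA) rin_conj.
  have -> : ('i%C : R[i])^*%C = - 'i%C by rewrite /= -[RHS]/(Complex (- 0) (- 1)) oppr0.
  by rewrite scaleNr rinNl rinC.
by move: h; lra.
Qed.

(** Since [<A x, x>] is real, pairing [A x - z x] with [i x] leaves [Im z |x|^2] up to sign;
    Cauchy-Schwarz concludes. *)
Lemma nonreal_bounded_below A (z : R[i]) : linear A -> rsym A -> complex.Im z != 0 ->
  bounded_below (fun x => A x - z *: x).
Proof.
move=> linA symA z0; exists `|complex.Im z|; split; first by rewrite normr_gt0.
move=> x; have [->|x0] := eqVneq (nrm x) 0; first by rewrite mulr0 nrm_ge0.
have {}x0 : 0 < nrm x by rewrite lt_def x0 nrm_ge0.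
rewrite -(ler_pM2r x0) -mulrA -expr2 nrm_sqr.
have := rin_CS (A x - z *: x) ('i%C *: x); rewrite nrm_i; apply: le_trans.
rewrite rinBl (rin_rsym_i _ linA symA) sub0r normrN.
have -> : z *: x = (complex.Re z)%:C%C *: x + (complex.Im z)%:C%C *: ('i%C *: x).
  by rewrite scalerA -scalerDl {1}[z]complexE [('i * _)%C]mulrC.
rewrite rinDl !rinZl rin_i.
have := @rin_rsym_i idfun x; rewrite /= => -> //.
by rewrite mulr0 add0r normrM (ger0_norm (rin_ge0 x)).
Qed.

Lemma spectrum_not_bounded_below A (z : R[i]) :
  ~ bounded_below (fun x => A x - z *: x) -> spectrum A z.
Proof.
apply: contra_not => -[B [/bounded_operatorP[_ [M [M0 bB]]] _ hB]].
exists M^-1; split; first by rewrite invr_gt0.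
move=> x; rewrite mulrC ler_pdivrMr// mulrC.
have {1}<- : B (A x - z *: x) = x by rewrite -[RHS]/(idfun x) -hB.
exact: bB.
Qed.

Lemma linear_shift A (a : R[i]) : linear A -> linear (fun x => A x - a *: x).
Proof.
by move=> linA b x y; rewrite linA scalerDr scalerBr !scalerA mulrC opprD addrACA.
Qed.

Lemma linear_scale A (a : R[i]) : linear A -> linear (fun x => a *: A x).
Proof. by move=> linA b x y; rewrite linA scalerDr !scalerA mulrC. Qed.

(** [m] is the infimum of [<A x, x>] over unit vectors. Then [A - m] is positive with a form
    arbitrarily small on unit vectors, which forces [|A x - m x|] to be small too. *)
Lemma inf_form A (K : R) (x0 : H) : linear A -> rsym A -> rbounded A K -> x0 != 0 ->
  exists m : R, (forall x, m * rin x x <= rin (A x) x) /\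
    ~ bounded_below (fun x => A x - m%:C%C *: x).
Proof.
move=> linA symA bA x00.
pose E := [set rin (A x) x | x in [set x | nrm x = 1]].
have unit x : x != 0 -> nrm ((nrm x)^-1%:C%C *: x) = 1.
  move=> x1; rewrite nrmZr ger0_norm ?invr_ge0 ?nrm_ge0//.
  by rewrite mulVf// nrm_eq0.
have Einf : has_inf E.
  split.
    pose v := (nrm x0)^-1%:C%C *: x0.
    by exists (rin (A v) v), v => //=; rewrite unit.
  exists (- K) => _ [x /= x1 <-].
  have := rin_CS (A x) x; rewrite x1 mulr1 => h.
  have := bA x; rewrite x1 mulr1 => h2.
  by have := le_trans h h2; rewrite ler_norml => /andP[].
have mE x : inf E * rin x x <= rin (A x) x.
  have [->|x1] := eqVneq x 0; first by rewrite !rin0r mulr0.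
  have : inf E <= rin (A ((nrm x)^-1%:C%C *: x)) ((nrm x)^-1%:C%C *: x).
    by apply: ge_inf; [exact: Einf.2|exists ((nrm x)^-1%:C%C *: x); rewrite /= ?unit].
  have n0 : 0 < nrm x by rewrite lt_def nrm_ge0 nrm_eq0 x1.
  rewrite (linZ _ _ linA) rinZl rinZr -nrm_sqr mulrA -expr2 exprVn mulrC.
  by rewrite ler_pdivlMr// exprn_gt0.
exists (inf E); split=> //; set m := inf E => -[c [c0 hc]].
pose S x := A x - m%:C%C *: x.
have linS : linear S by exact: linear_shift.
have symS : rsym S by move=> x y; rewrite /S !rinE symA.
have posS x : 0 <= rin (S x) x by rewrite /S rinBl rinZl subr_ge0.
pose L := `|K| + `|m| + 1.
have L0 : 0 < L by rewrite ltr_wpDl// addr_ge0.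
have bS : rbounded S L.
  move=> x; rewrite /S (le_trans (ler_nrmD _ _))// nrmN nrmZr /L !mulrDl mul1r.
  rewrite -[leLHS]addr0 lerD ?nrm_ge0// lerD// (le_trans (bA x))//.
  by rewrite ler_wpM2r ?nrm_ge0// ler_norm.
(* Cauchy-Schwarz for the positive form of S: |S x|^2 <= L <S x, x> *)
have key x : rin (S x) (S x) <= L * rin (S x) x.
  have h := positive_form_CS x (S x) linS symS posS.
  have [->|s0] := eqVneq (rin (S x) (S x)) 0; first by rewrite mulr_ge0// ltW.
  have s1 : 0 < rin (S x) (S x) by rewrite lt_def s0 rin_ge0.
  rewrite -(ler_pM2l s1) -expr2 (le_trans h)// mulrCA [leRHS]mulrA [leRHS]mulrC.
  rewrite ler_wpM2l// (le_trans (rin_le _ _))//.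
  by rewrite -nrm_sqr expr2 mulrA ler_wpM2r ?nrm_ge0// mulrC.
(* A lower bound [c] for [S] would give [c^2 <= |S x|^2 <= L <S x, x>] at every unit vector, against
   the choice of [x]. *)
have c2L : 0 < c ^+ 2 / L by rewrite divr_gt0 ?exprn_gt0.
have [_ [x /= x1 <-]] := inf_adherent c2L Einf.
apply/negP; rewrite -leNgt -/m -lerBrDl.
have -> : rin (A x) x - m = rin (S x) x.
  by rewrite /S rinBl rinZl -nrm_sqr x1 expr1n mulr1.
rewrite ler_pdivrMr// mulrC (le_trans _ (key x))// -nrm_sqr.
rewrite lerXn2r ?nnegrE ?nrm_ge0 ?(ltW c0)//.
by have := hc x; rewrite x1 mulr1.
Qed.

(** The vector [x0] excludes the zero space, whose operators have empty spectrum. *)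
Lemma spectrum_lower_point (p : {poly R}) A (x0 : H) : bounded_operator A ->
  rsym A -> x0 != 0 -> exists t : R, spectrum A t%:C%C /\
    forall x, p.[t] * rin x x <= rin (rpop p A x) x.
Proof.
move=> bA symA x00.
have linA : linear A by case: bA.
(* Factoring [q - m] requires it to be nonzero, hence [q] nonconstant; a constant [p] borrows its
   spectral point from ['X]. *)
have nonconst (q : {poly R}) : (1 < size q)%N -> exists t : R, spectrum A t%:C%C /\
    forall x, q.[t] * rin x x <= rin (rpop q A x) x.
  move=> q1; have [linq [K [_ bq]]] := (bounded_operatorP _).1 (rpop_bounded q bA).
  have [m [hm nb]] := inf_form linq (rpop_sym q linA symA) bq x00.
  have [||z [rz nz]] := @bounded_below_root (map_poly (real_complex R) (q - m%:P)) A linA.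
  - rewrite map_poly_eq0; apply: contraTneq q1 => /eqP; rewrite subr_eq0 => /eqP ->.
    by rewrite -leqNgt size_polyC leq_b1.
  - apply: contra_not nb => -[c [c0 hc]]; exists c; split=> // x.
    by rewrite -(rpopC m A x) -rpopB; exact: hc.
  have zr : complex.Im z = 0.
    by apply: contra_notP nz => /eqP; exact: nonreal_bounded_below.
  have zE : z = (complex.Re z)%:C%C by move: zr; case: (z) => a b /= ->.
  exists (complex.Re z); rewrite -zE; split; first exact: spectrum_not_bounded_below.
  move: rz; rewrite zE /root horner_map /= fmorph_eq0 !hornerE subr_eq0 => /eqP ->.
  exact: hm.
have [p1|p1] := ltnP 1 (size p); first exact: nonconst.
have [|t [st _]] := nonconst 'X; first by rewrite size_polyX.
exists t; split=> // x; have [c ->] : exists c, p = c%:P.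
  by exists p`_0; exact: size1_polyC.
by rewrite hornerC rpopC rinZl.
Qed.

Lemma rpop_pos (p : {poly R}) A x : bounded_operator A -> rsym A ->
  (forall t : R, spectrum A t%:C%C -> 0 <= p.[t]) -> 0 <= rin (rpop p A x) x.
Proof.
move=> bA symA hp; have [->|x0] := eqVneq x 0; first by rewrite rin0r.
have [t [st ht]] := spectrum_lower_point p bA symA x0.
by rewrite (le_trans _ (ht x))// mulr_ge0 ?rin_ge0// hp.
Qed.

(** Positivity of [c^2 - p^2] on the spectrum gives [|p(A) x|^2 = <p(A)^2 x, x> <= c^2 |x|^2]. *)
Lemma rpop_norm_le (p : {poly R}) A (c : R) x : bounded_operator A -> rsym A ->
  0 <= c -> (forall t : R, spectrum A t%:C%C -> `|p.[t]| <= c) ->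
  nrm (rpop p A x) <= c * nrm x.
Proof.
move=> bA symA c0 hp; have linA : linear A by case: bA.
have : 0 <= rin (rpop ((c ^+ 2)%:P - p * p) A x) x.
  apply: rpop_pos => // t /hp ht; rewrite !hornerE subr_ge0 -expr2.
  by rewrite -(real_normK (num_real p.[t])) lerXn2r// nnegrE.
rewrite rpopB rpopC rinBl rinZl (rpopM _ _ _ linA) rpop_sym// subr_ge0.
rewrite -!nrm_sqr -exprMn ler_sqr// nnegrE ?nrm_ge0//.
by rewrite mulr_ge0 ?nrm_ge0.
Qed.

(** [coercive_riesz] applied to the functionals [rin y] gives surjectivity; the lower bound
    [c |x| <= |S x|] gives injectivity and bounds the inverse. *)
Lemma coercive_inverse S (c K : R) : linear S -> rsym S -> rbounded S K -> 0 < c ->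
  (forall x, c * rin x x <= rin (S x) x) ->
  exists B, [/\ bounded_operator B, S \o B = idfun & B \o S = idfun].
Proof.
move=> linS symS bS c0 coS.
have lbS x : c * nrm x <= nrm (S x).
  have [->|x1] := eqVneq (nrm x) 0; first by rewrite mulr0 nrm_ge0.
  have x2 : 0 < nrm x by rewrite lt_def x1 nrm_ge0.
  by rewrite -(ler_pM2r x2) -mulrA -expr2 nrm_sqr (le_trans (coS x))// rin_le.
have injS x y : S x = S y -> x = y.
  move=> /eqP; rewrite -subr_eq0 -(linB _ _ linS) => /eqP h.
  apply/eqP; rewrite -subr_eq0 -nrm_eq0 eq_le nrm_ge0 andbT.
  by have := lbS (x - y); rewrite h nrm0 pmulr_rle0.
have /choice[B hB] y : exists u, S u = y.
  have [||u hu] := @coercive_riesz _ _ S (rin y) c K (nrm y) linS symS bS c0 coS.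
  - by move=> a x z; rewrite !rinE.
  - by move=> x; exact: rin_CS.
  by exists u; apply: rin_ext => x; rewrite hu.
exists B; split.
- apply/bounded_operatorP; split.
    by move=> a x y; apply: injS; rewrite linS !hB.
  exists c^-1; split; first by rewrite invr_gt0.
  by move=> x; rewrite mulrC ler_pdivlMr// mulrC -{2}(hB x).
- by apply/funext => x /=; rewrite hB.
- by apply/funext => x /=; apply: injS; rewrite hB.
Qed.

Lemma spectrum_pos A : bounded_operator A -> rsym A ->
  (forall x, 0 <= rin (A x) x) ->
  exists M : R, 0 < M /\ forall t : R, spectrum A t%:C%C -> 0 <= t <= M.
Proof.
move=> /bounded_operatorP[linA [M [M0 bA]]] symA posA.
(* The sign [s] is [1] for [t < 0] and [- 1] for [t > M], which makes [s (A - t)] coercive;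
   [s * s = 1] turns its inverse into one of [A - t]. *)
pose S (s t : R) x := s%:C%C *: (A x - t%:C%C *: x).
suff notin (s t c : R) : s * s = 1 -> 0 < c ->
    (forall x, c * rin x x <= rin (S s t x) x) -> ~ spectrum A t%:C%C.
  exists M; split=> // t st; apply/andP; split.
    have [//|t0] := leP 0 t; exfalso; apply: (notin 1 t (- t)) st; rewrite ?mulr1 ?oppr_gt0//.
    by move=> x; rewrite /S !rinE; have := posA x; lra.
  have [//|tM] := leP t M; exfalso; apply: (notin (-1) t (t - M)) st.
  - by rewrite mulrNN mulr1.
  - by rewrite subr_gt0.
  move=> x; rewrite /S !rinE; have := rin_le (A x) x.
  have := ler_wpM2r (nrm_ge0 x) (bA x); rewrite -mulrA -expr2 nrm_sqr; lra.
move=> ss c0 hc; have linA' := linear_shift t%:C%C linA.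
have linS : linear (S s t) by exact: linear_scale.
have symS : rsym (S s t) by move=> x y; rewrite /S !rinE symA.
have bS : rbounded (S s t) (`|s| * (M + `|t|)).
  move=> x; rewrite /S nrmZr -mulrA ler_wpM2l// (le_trans (ler_nrmD _ _))//.
  by rewrite nrmN nrmZr mulrDl lerD// bA.
have [B [bB SB BS]] := coercive_inverse linS symS bS c0 hc.
have ssc : s%:C%C * s%:C%C = 1 :> R[i] by rewrite -rmorphM ss rmorph1.
apply; exists (fun x => s%:C%C *: B x); split.
- have [linB [K [K0 hK]]] := (bounded_operatorP _).1 bB.
  apply/bounded_operatorP; split; first exact: linear_scale.
  exists (`|s| * K); split; last first.
    by move=> x; rewrite nrmZr -mulrA ler_wpM2l.
  rewrite mulr_gt0// normr_gt0; apply: contra_eq_neq ss => ->.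
  by rewrite mul0r eq_sym oner_neq0.
- apply/funext => y; transitivity ((S s t \o B) y); last by rewrite SB.
  exact: (linZ _ _ linA').
- apply/funext => y; transitivity ((B \o S s t) y); last by rewrite BS.
  by rewrite /= (linZ _ _ bB.1).
Qed.

End polynomials_of_operators.

(** * Continuous functional calculus of positive operators *)

Lemma uniform_cvgP {R : realType} (E : set R) (g : nat -> R -> R) (f : R -> R) :
  {uniform E, g @ \oo --> f} <-> forall e : R, 0 < e ->
    exists N, forall n, (N <= n)%N -> forall t, E t -> `|g n t - f t| <= e.
Proof.
split=> [gf e e0|gf P].
  have : nbhs (f : {uniform` E -> R}) [set h | forall t, E t -> `|f t - h t| < e].
    apply/uniform_nbhs; exists [set xy | ball xy.1 e xy.2]; split=> //.
    exact: (entourage_ball R (PosNum e0)).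
  move=> /gf[N _ hN]; exists N => n Nn t Et.
  by rewrite distrC ltW// (hN n Nn).
move=> /uniform_nbhs[V [entV VP]].
move: entV; rewrite -entourage_ballE => -[e /= e0 eV].
have [N hN] := gf _ (divr_gt0 e0 (ltr0n _ 2)).
exists N => // n /= Nn; apply: VP => t Et; apply: eV => /=.
rewrite /ball /= distrC (le_lt_trans (hN n Nn t Et))//.
by rewrite ltr_pdivrMr// mulr_natr mulr2n ltrDl.
Qed.

(** Passage to the limit [e -> 0]; the restriction [e <= 1] lets [e ^+ 2] be absorbed into [e]. *)
Lemma le_eps {R : realFieldType} (a b C : R) :
  (forall e, 0 < e -> e <= 1 -> a <= b + e * C) -> a <= b.
Proof.
move=> h; apply/ler_addgt0Pr => e e0.
have C0 : 0 < `|C| + 1 by rewrite ltr_wpDl.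
pose d := Num.min 1 (e / (`|C| + 1)).
have d0 : 0 < d by rewrite lt_min ltr01 divr_gt0.
rewrite (le_trans (h d d0 _)) ?ge_min ?lexx// lerD2l.
rewrite (@le_trans _ _ (d * (`|C| + 1)))//.
  by rewrite ler_pM2l// (le_trans (ler_norm C))// lerDl.
by rewrite -ler_pdivlMr// ge_min lexx orbT.
Qed.

Section functional_calculus.
Context {R : realType} {H : hilbertType R}.
Implicit Types (x y z : H) (A B S T : H -> H) (f : R -> R) (p : {poly R}).

Let opnorm_has_sup T : bounded_operator T ->
  has_sup [set complex.Re `|T x| | x in [set x : H | `|x| <= 1]].
Proof.
move=> /bounded_operatorP[linT [M [M0 bT]]]; split.
  by exists (nrm (T 0)), 0 => //=; rewrite normr0.
exists M => _ [x /= + <-]; rewrite nrmE -[1]/(1%:C%C) lecR => x1.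
by rewrite -/(nrm _) (le_trans (bT x))// -{2}(mulr1 M) ler_pM2l.
Qed.

Lemma opnorm_bound T x : bounded_operator T -> nrm (T x) <= opnorm T * nrm x.
Proof.
move=> bT; have linT : linear T by case: bT.
have [->|x0] := eqVneq x 0; first by rewrite (lin0 linT) !nrm0 mulr0.
have n0 : 0 < nrm x by rewrite lt_def nrm_ge0 nrm_eq0 x0.
rewrite -ler_pdivrMr//.
have -> : nrm (T x) / nrm x = nrm (T ((nrm x)^-1%:C%C *: x)).
  by rewrite (linZ _ _ linT) nrmZr ger0_norm ?invr_ge0 ?nrm_ge0// mulrC.
apply: sup_ubound; first exact: (opnorm_has_sup bT).2.
exists ((nrm x)^-1%:C%C *: x) => //=.
rewrite nrmE nrmZr ger0_norm ?invr_ge0 ?nrm_ge0// mulVf ?gt_eqF//.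
Qed.

Lemma opnorm_ge0 T : bounded_operator T -> 0 <= opnorm T.
Proof.
move=> bT; rewrite (le_trans (nrm_ge0 (T 0)))//; apply: sup_ubound.
  exact: (opnorm_has_sup bT).2.
by exists 0 => //=; rewrite normr0.
Qed.

Lemma opnorm_le T (c : R) : (forall x, nrm (T x) <= c * nrm x) -> 0 <= c ->
  opnorm T <= c.
Proof.
move=> h c0; apply: ge_sup; first by exists (nrm (T 0)), 0 => //=; rewrite normr0.
move=> _ [x /= + <-]; rewrite nrmE -[1]/(1%:C%C) lecR => x1.
by rewrite -/(nrm _) (le_trans (h x))// -{2}(mulr1 c) ler_wpM2l.
Qed.

Lemma bounded_operatorB A B : bounded_operator A -> bounded_operator B ->
  bounded_operator (A - B).
Proof.
move=> /bounded_operatorP[linA [K [K0 bA]]] /bounded_operatorP[linB [L [L0 bB]]].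
apply/bounded_operatorP; split.
  move=> a x y; rewrite -[LHS]/(A (a *: x + y) - B (a *: x + y)).
  by rewrite linA linB opprD addrACA -scalerBr.
exists (K + L); split; first exact: addr_gt0.
move=> x; rewrite -[(A - B) x]/(A x - B x) (le_trans (ler_nrmD _ _))//.
by rewrite nrmN mulrDl lerD.
Qed.

Lemma bounded_operatorD A B : bounded_operator A -> bounded_operator B ->
  bounded_operator (A + B).
Proof.
move=> /bounded_operatorP[linA [K [K0 bA]]] /bounded_operatorP[linB [L [L0 bB]]].
apply/bounded_operatorP; split.
  move=> a x y; rewrite -[LHS]/(A (a *: x + y) + B (a *: x + y)).
  by rewrite linA linB addrACA -scalerDr.
exists (K + L); split; first exact: addr_gt0.
move=> x; rewrite -[(A + B) x]/(A x + B x) (le_trans (ler_nrmD _ _))//.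
by rewrite mulrDl lerD.
Qed.

Lemma bounded_operator_comp A B : bounded_operator A -> bounded_operator B ->
  bounded_operator (A \o B).
Proof.
move=> /bounded_operatorP[linA [K [K0 bA]]] /bounded_operatorP[linB [L [L0 bB]]].
apply/bounded_operatorP; split; first by move=> a x y; rewrite /= linB linA.
exists (K * L); split; first exact: mulr_gt0.
by move=> x; rewrite (le_trans (bA _))// -mulrA ler_pM2l.
Qed.

Lemma nrm_le_eps x (C : R) :
  (forall e, 0 < e -> e <= 1 -> nrm x <= e * C) -> x = 0.
Proof.
move=> h; apply/eqP; rewrite -nrm_eq0 eq_le nrm_ge0 andbT.
by apply: (@le_eps _ _ _ C) => e e0 e1; rewrite add0r h.
Qed.

Definition positive_operator A :=
  [/\ bounded_operator A, rsym A & forall x, 0 <= rin (A x) x].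

Lemma within_itvcy f (M : R) : {within [set t : R | 0 <= t], continuous f} ->
  {within `[0, M], continuous f}.
Proof.
by apply: continuous_subspaceW => t /=; rewrite in_itv /= => /andP[].
Qed.

(** This justifies the choice made by [cfc]. Polynomials within [1/(n+1)] of [f] on an interval
    containing the spectrum make [p_n(A) x] a Cauchy sequence, by [rpop_norm_le]. *)
Lemma cfc_exists f A : positive_operator A ->
  {within [set t : R | 0 <= t], continuous f} ->
  exists B, bounded_operator B /\
    exists p : nat -> {poly R},
      {uniform [set t : R | spectrum A t%:C%C],
        (fun n t => (p n).[t]) @ \oo --> f} /\
      opnorm (poly_operator (p n) A - B) @[n --> \oo] --> (0 : R).
Proof.
move=> [bA symA posA] cf.
have [M [M0 hM]] := spectrum_pos bA symA posA.
have /choice[p hp] (n : nat) : exists p : {poly R}, forall t : R, 0 <= t <= M ->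
    `|p.[t] - f t| <= n.+1%:R^-1.
  by apply: weierstrass => //; exact: within_itvcy.
have pp (m n : nat) x : nrm (rpop (p m) A x - rpop (p n) A x) <=
    (m.+1%:R^-1 + n.+1%:R^-1) * nrm x.
  rewrite -rpopB; apply: rpop_norm_le => //.
  move=> t /hM tM; rewrite !hornerE (le_trans (ler_distD (f t) _ _))// lerD ?hp//.
  by rewrite distrC hp.
have /choice[B hB] x : exists l, forall e : R, 0 < e -> exists N, forall n, (N <= n)%N ->
    nrm (rpop (p n) A x - l) <= e.
  apply: nrm_cauchy_cvg => e e0.
  have [|N hN] := @eventually_invS_le R (e / 2 / (nrm x + 1)).
    by rewrite !divr_gt0// ltr_wpDl// nrm_ge0.
  exists N => m n /hN Nm /hN Nn; rewrite (le_trans (pp _ _ _))//.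
  rewrite (le_trans (ler_wpM2r (nrm_ge0 x) (lerD Nm Nn)))//.
  rewrite -mulrDl -splitr mulrAC ler_pdivrMr ?ltr_wpDl ?nrm_ge0//.
  by rewrite ler_pM2l// lerDl.
(* Letting the second index of [pp] tend to infinity keeps only the rate in [n], uniform over the
   unit ball; this is convergence in operator norm. *)
have pB n x : nrm (rpop (p n) A x - B x) <= n.+1%:R^-1 * nrm x.
  apply: (@le_eps _ _ _ (1 + nrm x)) => e e0 _.
  have [N1 h1] := hB x e e0; have [N2 h2] := eventually_invS_le e0.
  pose k := maxn N1 N2.
  rewrite (le_trans (ler_nrmB _ (rpop (p k) A x) _))//.
  have := pp n k x; have := h1 k (leq_maxl _ _).
  have := ler_wpM2r (nrm_ge0 x) (h2 k (leq_maxr _ _)).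
  by rewrite mulrDl; move: (n.+1%:R^-1) (k.+1%:R^-1) => i j; lra.
have linp n := rpop_linear (p n) bA.1.
have linB : linear B.
  move=> a x y; apply/eqP; rewrite -subr_eq0; apply/eqP.
  apply: (@nrm_le_eps _ (nrm (a *: x + y) + complex.Re `|a| * nrm x + nrm y)) => e e0 _.
  have [N hN] := eventually_invS_le e0; have {}hN := hN N (leqnn N).
  have q z : nrm (rpop (p N) A z - B z) <= e * nrm z.
    by rewrite (le_trans (pB _ _))// ler_wpM2r ?nrm_ge0.
  rewrite (le_trans (ler_nrmB _ (rpop (p N) A (a *: x + y)) _))// -addrA mulrDr lerD//.
    by rewrite nrmB.
  rewrite linp opprD addrACA -scalerBr (le_trans (ler_nrmD _ _))// nrmZ mulrDr.
  rewrite lerD// mulrCA ler_wpM2l// -ler0c RRe_real ?normr_real//.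
have bB : bounded_operator B.
  have /bounded_operatorP[_ [K [K0 hK]]] := rpop_bounded (p 0%N) bA.
  apply/bounded_operatorP; split=> //; exists (K + 1); split; first exact: addr_gt0.
  move=> x; rewrite -[B x](subrK (rpop (p 0%N) A x)) (le_trans (ler_nrmD _ _))//.
  rewrite addrC mulrDl lerD// nrmB (le_trans (pB _ _))// invr1//.
exists B; split=> //; exists p; split.
  apply/uniform_cvgP => e /eventually_invS_le[N hN]; exists N => n /hN Nn t /hM tM.
  by rewrite (le_trans (hp _ _ tM)).
apply/cvgrPdist_le => e /eventually_invS_le[N hN]; exists N => // n /= /hN Nn.
rewrite sub0r normrN ger0_norm; last first.
  by apply/opnorm_ge0/bounded_operatorB => //; rewrite poly_operatorE; exact: rpop_bounded.
rewrite (le_trans _ Nn)//; apply: opnorm_le => // x.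
by rewrite poly_operatorE -[(_ - B) x]/(rpop (p n) A x - B x) pB.
Qed.

Section cfc_theory.
Variables (f : R -> R) (A : H -> H).
Hypothesis posA : positive_operator A.
Hypothesis cf : {within [set t : R | 0 <= t], continuous f}.

Lemma cfc_bounded : bounded_operator (cfc f A).
Proof. by have /getPex[] := cfc_exists posA cf. Qed.

(** Comparison with the sequence [q] hidden in the choice of [cfc] transfers any polynomial
    approximation of [f] on the spectrum to [cfc f A]. *)
Lemma cfc_dist p (e : R) x : 0 <= e ->
  (forall t : R, spectrum A t%:C%C -> `|p.[t] - f t| <= e) ->
  nrm (rpop p A x - cfc f A x) <= e * nrm x.
Proof.
have [bA symA _] := posA.
have := cfc_exists posA cf => /getPex[]; rewrite -/(cfc f A) => bB [q [qf qB]].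
move=> e0 pf; apply: (@le_eps _ _ _ (2 * nrm x)) => d d0 _.
have [N1 h1] := (uniform_cvgP _ _ _).1 qf d d0.
have [N2 _ h2] := (cvgrPdist_le _ _).1 qB d d0.
pose n := maxn N1 N2; have {}h1 := h1 n (leq_maxl _ _).
have := h2 n (leq_maxr _ _); rewrite /= sub0r normrN => {}h2.
rewrite (le_trans (ler_nrmB _ (rpop (q n) A x) _))//.
have s1 : nrm (rpop p A x - rpop (q n) A x) <= (e + d) * nrm x.
  rewrite -rpopB; apply: rpop_norm_le => //; first by rewrite addr_ge0// ltW.
  move=> t st; rewrite !hornerE (le_trans (ler_distD (f t) _ _))// lerD ?pf//.
  by rewrite distrC h1.
have s2 : nrm (rpop (q n) A x - cfc f A x) <= d * nrm x.
  have bq : bounded_operator (poly_operator (q n) A - cfc f A).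
    by apply: bounded_operatorB => //; rewrite poly_operatorE; exact: rpop_bounded.
  have := opnorm_bound x bq.
  rewrite -[(_ - cfc f A) x]/(poly_operator (q n) A x - cfc f A x) {1}poly_operatorE.
  move=> /le_trans; apply; rewrite ler_wpM2r ?nrm_ge0//.
  exact: le_trans (ler_norm _) h2.
by move: s1 s2; lra.
Qed.

Lemma cfc_approx (e : R) : 0 < e -> exists p,
  (forall t : R, spectrum A t%:C%C -> `|p.[t] - f t| <= e) /\
  forall x, nrm (rpop p A x - cfc f A x) <= e * nrm x.
Proof.
move=> e0; have [bA symA qA] := posA.
have [M [M0 hM]] := spectrum_pos bA symA qA.
have [p hp] := weierstrass M0 e0 (within_itvcy cf).
exists p; have h : forall t : R, spectrum A t%:C%C -> `|p.[t] - f t| <= e.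
  by move=> t /hM; exact: hp.
by split=> // x; apply: cfc_dist => //; exact: ltW.
Qed.

Lemma cfc_sym : rsym (cfc f A).
Proof.
have [bA symA _] := posA.
move=> x y; apply/eqP; rewrite -subr_eq0 -normr_eq0 eq_le normr_ge0 andbT.
apply: (@le_eps _ _ _ (2 * nrm x * nrm y)) => e e0 _; rewrite add0r.
have [p [_ hp]] := cfc_approx e0.
have -> : rin (cfc f A x) y - rin x (cfc f A y) =
   rin x (rpop p A y - cfc f A y) - rin (rpop p A x - cfc f A x) y.
  by rewrite rinBr rinBl (rpop_sym p bA.1 symA x y); ring.
rewrite (le_trans (ler_normB _ _))//.
have := rin_CS x (rpop p A y - cfc f A y).
have := rin_CS (rpop p A x - cfc f A x) y.
have := ler_wpM2l (nrm_ge0 x) (hp y); have := ler_wpM2r (nrm_ge0 y) (hp x).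
lra.
Qed.

(** If [p] is within [e] of [f], then [p - (a - e) - c X] is nonnegative on the spectrum. The zero
    minorant will give positivity, a supporting line Jensen's inequality. *)
Lemma cfc_lower (a c : R) x : (forall t : R, 0 <= t -> a + c * t <= f t) ->
  a * rin x x + c * rin (A x) x <= rin (cfc f A x) x.
Proof.
have [bA symA qA] := posA; have [M [M0 hM]] := spectrum_pos bA symA qA.
move=> h; apply: (@le_eps _ _ _ (2 * rin x x)) => e e0 _.
have [p [hp1 hp]] := cfc_approx e0.
have : 0 <= rin (rpop (p - (a - e)%:P - c *: 'X) A x) x.
  apply: rpop_pos => // t st; have /andP[t0 _] := hM t st.
  by have := hp1 t st; have := h t t0; rewrite !hornerE ler_norml => ? /andP[]; lra.
rewrite !rpopB rpopZ rpopC rpopX !rinE => h1.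
have := rin_CS (rpop p A x - cfc f A x) x; rewrite rinBl ler_norml => /andP[_].
by have := ler_wpM2r (nrm_ge0 x) (hp x); rewrite -mulrA -expr2 nrm_sqr; lra.
Qed.

End cfc_theory.

(** For polynomials this is an induction, and one polynomial approximates [f] on both spectra, which
    lie in [[0, max M L]]. *)
Lemma cfc_intertwine f A B T : positive_operator A -> positive_operator B ->
  {within [set t : R | 0 <= t], continuous f} -> bounded_operator T ->
  (forall x, T (A x) = B (T x)) -> forall x, T (cfc f A x) = cfc f B (T x).
Proof.
move=> posA posB cf /bounded_operatorP[linT [K [K0 bT]]] TA x.
have [bA symA qA] := posA; have [M [M0 hM]] := spectrum_pos bA symA qA.
have [bB symB qB] := posB; have [L [L0 hL]] := spectrum_pos bB symB qB.
have TpA p y : T (rpop p A y) = rpop p B (T y).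
  elim/poly_ind: p y => [|p c IH] y; first by rewrite /rpop rmorph0 !cpop0 (lin0 linT).
  by rewrite !rpop_cons (linD _ _ linT) (linZ _ _ linT) IH TA.
apply/eqP; rewrite -subr_eq0; apply/eqP.
apply: (@nrm_le_eps _ (K * nrm x + nrm (T x))) => e e0 _.
have ML : 0 < Num.max M L by rewrite lt_max M0.
have [p hp] := weierstrass ML e0 (within_itvcy cf).
rewrite (le_trans (ler_nrmB _ (T (rpop p A x)) _))// mulrDr lerD//.
  rewrite nrmB -(linB _ _ linT) mulrCA (le_trans (bT _))// ler_pM2l//.
  apply: cfc_dist => //; first exact: ltW.
  by move=> t /hM /andP[t0 tM]; apply: hp; rewrite t0 le_max tM.
rewrite TpA; apply: cfc_dist => //; first exact: ltW.
by move=> t /hL /andP[t0 tM]; apply: hp; rewrite t0 le_max tM orbT.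
Qed.

Lemma sqrt_within : {within [set t : R | 0 <= t], continuous (@Num.sqrt R)}.
Proof. by apply: continuous_subspaceT => t; exact: sqrt_continuous. Qed.

Lemma cfc_sqrtK A x : positive_operator A -> cfc Num.sqrt A (cfc Num.sqrt A x) = A x.
Proof.
move=> posA; have [bA symA qA] := posA; have [M [M0 hM]] := spectrum_pos bA symA qA.
have /bounded_operatorP[lB [K [K0 bB]]] := cfc_bounded posA sqrt_within.
set B := cfc _ _ in lB bB *.
apply/eqP; rewrite -subr_eq0; apply/eqP.
(* With [s = sqrt t], [|p^2 - s^2| = |p - s| |p - s + 2 s| <= e (2 sqrt M + 1)]; the part
   [e (2 K + 1)] bounds [p(A)^2 - B^2] by passing through [B p(A)]. *)
apply: (@nrm_le_eps _ ((2 * Num.sqrt M + 1 + (2 * K + 1)) * nrm x)) => e e0 e1.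
have [p [p1 p2]] := cfc_approx posA sqrt_within e0; rewrite -/B in p2.
rewrite (le_trans (ler_nrmB _ (rpop (p * p) A x) _))// addrC mulrDl mulrDr lerD//.
  rewrite -[A x]rpopX -rpopB mulrA; apply: rpop_norm_le => //.
    by rewrite mulr_ge0 ?(ltW e0)// addr_ge0// mulr_ge0// sqrtr_ge0.
  move=> t st; have /andP[t0 tM] := hM t st.
  have := p1 t st; rewrite !hornerE -[X in `|_ * _ - X|](sqr_sqrtr t0).
  have : 0 <= Num.sqrt t by exact: sqrtr_ge0.
  have : Num.sqrt t <= Num.sqrt M by rewrite ler_sqrt// ltW.
  move: (Num.sqrt t) (Num.sqrt M) => s m sm s0 ps.
  have -> : p.[t] * p.[t] - s ^+ 2 = (p.[t] - s) * (p.[t] - s + 2 * s) by ring.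
  rewrite normrM ler_pM// (le_trans (ler_normD _ _))// addrC lerD//; last exact: le_trans e1.
  by rewrite ger0_norm ?mulr_ge0// ler_pM2l.
rewrite nrmB (rpopM _ _ _ bA.1) (le_trans (ler_nrmB _ (B (rpop p A x)) _))//.
have h1 := p2 (rpop p A x); have h2 := p2 x.
rewrite -(linB _ _ lB); have h3 := bB (rpop p A x - B x).
have h4 : nrm (rpop p A x) <= (e + K) * nrm x.
  rewrite -[rpop p A x](subrK (B x)) (le_trans (ler_nrmD _ _))// mulrDl lerD//.
have h5 := ler_wpM2l (ltW e0) h4; have h6 := ler_wpM2l (ltW K0) h2.
have h7 := mulr_ge0 (ltW e0) (nrm_ge0 x).
have h8 := ler_wpM2r h7 e1.
lra.
Qed.

End functional_calculus.

(** * Absolute values and the mixed Schwarz inequality *)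

Section absolute_value.
Context {R : realType} {H : hilbertType R}.
Implicit Types (x y z : H) (A B S T : H -> H).

Lemma adjointK T : bounded_operator T -> adjoint (adjoint T) = T.
Proof.
move=> bT; have [bS hS] := adjointP bT; have [_ hU] := adjointP bS.
by apply/funext => x; apply: rin_ext => y; rewrite rinC -hU rinC hS.
Qed.

Lemma adjoint_comp_pos T : bounded_operator T -> positive_operator (adjoint T \o T).
Proof.
move=> bT; have [bS hS] := adjointP bT; split.
- exact: bounded_operator_comp.
- by move=> x y /=; rewrite -hS rinC -hS rinC.
- by move=> x /=; rewrite rinC -hS rin_ge0.
Qed.

Lemma absop_pos T : bounded_operator T -> positive_operator (absop T).
Proof.
move=> /adjoint_comp_pos pT; split.
- exact: cfc_bounded pT sqrt_within.
- exact: cfc_sym pT sqrt_within.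
- move=> x; rewrite (le_trans _ (cfc_lower (a := 0) (c := 0) pT sqrt_within x _))//.
    by rewrite !mul0r addr0.
  by move=> t _; rewrite mul0r addr0 sqrtr_ge0.
Qed.

Lemma absop_sqr T x : bounded_operator T -> absop T (absop T x) = adjoint T (T x).
Proof. by move=> /adjoint_comp_pos pT; rewrite /absop cfc_sqrtK. Qed.

(** [T] intertwines [adjoint T \o T] with [T \o adjoint T], hence also their square roots;
    [adjointK] identifies the second product with the one under the root in [absop (adjoint T)]. *)
Lemma absop_intertwine T x : bounded_operator T ->
  T (absop T x) = absop (adjoint T) (T x).
Proof.
move=> bT; have [bS _] := adjointP bT; apply: cfc_intertwine => //.
- exact: adjoint_comp_pos.
- exact: adjoint_comp_pos.
- exact: sqrt_within.
- by move=> y; rewrite /= adjointK.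
Qed.

Lemma positive_sqr A : positive_operator A -> positive_operator (A \o A).
Proof.
move=> [bA symA _]; split; first exact: bounded_operator_comp.
- by move=> x y; rewrite /= !symA.
- by move=> x; rewrite /= symA rin_ge0.
Qed.

(* With x = (|T| + e) v, intertwining gives <T x, y> = <(|T*| + e) T v, y>;
   apply Cauchy-Schwarz to the positive form of |T*| + e and let e tend to 0. *)
Lemma mixed_schwarz T x y : bounded_operator T ->
  rin (T x) y ^+ 2 <= rin (absop T x) x * rin (absop (adjoint T) y) y.
Proof.
move=> bT; have [bS hS] := adjointP bT.
have [[linP bP'] symP posP] := absop_pos bT.
have [_ [K [K0 bP]]] := (bounded_operatorP _).1 (conj linP bP').
have [[linQ _] symQ posQ] := absop_pos bS.
have sqrP v := absop_sqr v bT; have TPQ v := absop_intertwine v bT.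
have linT := bT.1.
set P := absop T in linP bP symP posP sqrP TPQ *.
set Q := absop (adjoint T) in linQ symQ posQ TPQ *.
apply: (@le_eps _ _ _ (rin (P x) x * rin y y)) => e e0 _.
have linE (A : H -> H) : linear A -> linear (fun v => A v + e%:C%C *: v).
  by move=> lA a u v; rewrite lA !scalerDr !scalerA mulrC addrACA.
have symE (A : H -> H) : rsym A -> rsym (fun v => A v + e%:C%C *: v).
  by move=> sA u v; rewrite !rinE sA.
have posE (A : H -> H) : (forall v, 0 <= rin (A v) v) ->
    forall v, 0 <= rin (A v + e%:C%C *: v) v.
  by move=> pA v; rewrite !rinE addr_ge0// mulr_ge0 ?rin_ge0// ltW.
have bE : rbounded (fun v => P v + e%:C%C *: v) (K + e).
  by move=> v; rewrite (le_trans (ler_nrmD _ _))// mulrDl nrmZr gtr0_norm// lerD.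
have coE v : e * rin v v <= rin (P v + e%:C%C *: v) v.
  by rewrite !rinE lerDr.
have [W [_ hW _]] := coercive_inverse (linE _ linP) (symE _ symP) bE e0 coE.
have [v ->] : exists v, x = P v + e%:C%C *: v.
  by exists (W x); rewrite -[LHS]/(idfun x) -hW.
have := positive_form_CS (T v) y (linE _ linQ) (symE _ symQ) (posE _ posQ).
rewrite -TPQ -(linZ _ _ linT) -(linD _ _ linT) => h.
apply: (le_trans h); rewrite !(linD _ _ linP) (linZ _ _ linP).
have -> : rin (Q y + e%:C%C *: y) y = rin (Q y) y + e * rin y y by rewrite !rinE.
rewrite [e * (_ * _)]mulrCA -mulrDr ler_wpM2r//.
  by rewrite addr_ge0// mulr_ge0 ?rin_ge0// ltW.
(* For [x = (P + e) v] the two sides differ by [e <P^2 v, v> + e^2 <P v, v>], which is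
   nonnegative. *)
rewrite hS -sqrP !rinE -!symP.
have h1 : 0 <= rin (P (P v)) v by rewrite symP rin_ge0.
have := mulr_ge0 (ltW e0) h1; have := mulr_ge0 (sqr_ge0 e) (posP v); lra.
Qed.

End absolute_value.

(** * Numerical radius, phases and Buzano's inequality *)

Section numerical_radius.
Context {R : realType} {H : hilbertType R}.
Implicit Types (x y z : H) (A B S T : H -> H).

Let numerical_radius_bounded T : bounded_operator T ->
  has_ubound [set complex.Re `|inner (T x) x| | x in [set x : H | `|x| = 1]].
Proof.
move=> /bounded_operatorP[linT [M [M0 bT]]].
(* Real and imaginary parts are at most [M] each in absolute value, and [sqrt 2 M <= 2 M]. *)
exists (2 * M) => _ [x x1 <-].
have {}x1 : nrm x = 1 by move: x1 => /= x1; rewrite /nrm x1.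
rewrite innerE normc_def /=.
have h y : nrm y = 1 -> `|rin (T x) y| <= M.
  by move=> y1; rewrite (le_trans (rin_CS _ _))// y1 mulr1 -[M]mulr1 -x1.
have h1 := h _ x1; have h2 := h ('i%C *: x) (etrans (nrm_i x) x1).
rewrite -[2 * M]ger0_norm ?mulr_ge0 ?(ltW M0)// -sqrtr_sqr ler_sqrt ?sqr_ge0//.
rewrite -(real_normK (num_real (rin (T x) x))).
rewrite -(real_normK (num_real (rin (T x) ('i%C *: x)))).
have s1 := lerXn2r 2 (normr_ge0 _) (ltW M0) h1.
have s2 := lerXn2r 2 (normr_ge0 _) (ltW M0) h2.
have := sqr_ge0 M; rewrite exprMn; lra.
Qed.

Lemma numerical_radius_ge T x : bounded_operator T -> nrm x = 1 ->
  complex.Re `|inner (T x) x| <= numerical_radius T.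
Proof.
move=> bT x1; apply: sup_ubound; first exact: numerical_radius_bounded.
by exists x => //=; rewrite nrmE x1.
Qed.

Lemma Re_norm_ge0 (z : R[i]) : 0 <= complex.Re `|z|.
Proof. by rewrite -ler0c RRe_real ?normr_real. Qed.

Lemma Re_norm_sqr (z : R[i]) :
  complex.Re `|z| ^+ 2 = complex.Re z ^+ 2 + complex.Im z ^+ 2.
Proof. by rewrite normc_def -[complex.Re _%:C%C]/(Num.sqrt _) sqr_sqrtr// addr_ge0 ?sqr_ge0. Qed.

Lemma numerical_radius_ge0 T : bounded_operator T -> 0 <= numerical_radius T.
Proof.
move=> bT; have [[x /= x1]|/forallNP h] := pselect (exists x : H, `|x| = 1).
  apply: le_trans (numerical_radius_ge bT (_ : nrm x = 1)); first exact: Re_norm_ge0.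
  by rewrite /nrm x1.
(* Without unit vectors the supremum is that of the empty set, which is [0] by convention. *)
rewrite /numerical_radius (_ : [set x : H | _] = set0) ?image_set0 ?sup0//.
by apply/seteqP; split=> // x /h.
Qed.

(** A positive radius guarantees that unit vectors exist, so that the supremum is approached. *)
Lemma numerical_radius_approx T (e : R) : bounded_operator T ->
  0 < numerical_radius T -> 0 < e ->
  exists2 x, nrm x = 1 & numerical_radius T - e < complex.Re `|inner (T x) x|.
Proof.
move=> bT w0 e0; have [_ [x /= x1 <-] hx]//: exists2 r,
    [set complex.Re `|inner (T x) x| | x in [set x : H | `|x| = 1]] r &
    numerical_radius T - e < r.
  apply: sup_adherent => //; split; last exact: numerical_radius_bounded.
  apply/set0P; apply: contraTneq w0 => h.
  by rewrite /numerical_radius h sup0 ltxx.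
by exists x => //; rewrite /nrm x1.
Qed.

Lemma rin_rotation (z : R[i]) x y : z^*%C * z = 1 -> rin (z *: x) (z *: y) = rin x y.
Proof. by move=> h; rewrite rin_conj scalerA h scale1r. Qed.

(** The phase is [z = <x, y> / |<x, y>|]: conjugate-linearity in the second argument gives
    [<x, z y> = |<x, y>|]. *)
Lemma inner_rotation x y :
  exists z : R[i], z^*%C * z = 1 /\ complex.Re `|inner x y| = rin x (z *: y).
Proof.
have [w0|w0] := eqVneq (inner x y) 0.
  exists 1; split; first by rewrite conjc1 mulr1.
  by rewrite w0 normr0 scale1r /rin w0.
pose r := complex.Re `|inner x y|.
have rE : `|inner x y| = r%:C%C by rewrite RRe_real ?normr_real.
have r0 : r != 0 by rewrite -(inj_eq (@complexI R)) -rE normr_eq0.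
have rr : inner x y * (inner x y)^*%C = (r ^+ 2)%:C%C.
  by rewrite -sqr_normc rE rmorphXn.
have cr : (r^-1%:C%C)^*%C = r^-1%:C%C := conjc_real _.
exists (inner x y * r^-1%:C%C); split.
  rewrite rmorphM /= mulrACA [_^*%C * inner x y]mulrC rr.
  by rewrite -[X in _ * (X * _)]/((r^-1%:C%C)^*%C) cr -!rmorphM -expr2 exprVn divff ?expf_neq0.
rewrite /rin linearZr_LR /= rmorphM /= mulrAC [_^*%C * inner x y]mulrC rr.
by rewrite -[X in _ * X]/((r^-1%:C%C)^*%C) cr -rmorphM /= expr2 mulfK.
Qed.

(** A phase on the second vector turns the modulus into a real part without changing the form of
    [absop (adjoint T)]. *)
Lemma numerical_range_mixed_schwarz T x : bounded_operator T ->
  complex.Re `|inner (T x) x| ^+ 2 <=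
    rin (absop T x) x * rin (absop (adjoint T) x) x.
Proof.
move=> bT; have [z [z1 ->]] := inner_rotation (T x) x.
rewrite (le_trans (mixed_schwarz _ _ bT))//.
have [[linQ _] _ _] := absop_pos (adjointP bT).1.
by rewrite (linZ _ _ linQ) rin_rotation.
Qed.

(* 2 <x, y> y - x is the reflection of x across the line of y. *)
Lemma buzano x y z : nrm y = 1 ->
  2 * (rin x y * rin z y) <= nrm x * nrm z + rin x z.
Proof.
move=> y1; pose v := (2 * rin x y)%:C%C *: y - x.
have nv : nrm v = nrm x.
  apply/eqP; rewrite -(@eqrXn2 _ 2) ?nrm_ge0// !nrm_sqr /v !rinE -[rin y y]nrm_sqr y1.
  by rewrite [rin y x]rinC; apply/eqP; ring.
have := rin_le v z; rewrite nv /v !rinE [rin y z]rinC; lra.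
Qed.

End numerical_radius.

(** * Orlicz functions: supporting lines, Jensen's inequality, dyadic means *)

Section orlicz_functions.
Context {R : realType} (phi : R -> R).
Hypothesis hphi : orlicz phi.

(** Convexity at [s], written as the mean of [t] and [u] with weight [(u - s) / (u - t)] on [t]. *)
Lemma orlicz_slopes (t s u : R) : 0 <= t -> t < s -> s < u ->
  (phi s - phi t) / (s - t) <= (phi u - phi s) / (u - s).
Proof.
move=> t0 ts su.
have ut : 0 < u - t by rewrite subr_gt0 (lt_trans ts).
have := orlicz_convex hphi (a := (u - s) / (u - t)) _ t0 (ltW (lt_trans (le_lt_trans t0 ts) su)).
have -> : (u - s) / (u - t) * t + (1 - (u - s) / (u - t)) * u = s.
  by field; rewrite gt_eqF.
have -> : (u - s) / (u - t) * phi t + (1 - (u - s) / (u - t)) * phi u =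
    ((u - s) * phi t + (s - t) * phi u) / (u - t).
  by field; rewrite gt_eqF.
move=> h.
have us0 : 0 < u - s by rewrite subr_gt0.
have st0 : 0 < s - t by rewrite subr_gt0.
rewrite ler_pdivrMr// mulrAC ler_pdivlMr//.
have : phi s * (u - t) <= (u - s) * phi t + (s - t) * phi u.
  rewrite -ler_pdivlMr//; apply: h; rewrite divr_ge0 ?(ltW us0) ?(ltW ut)//=.
  by rewrite ler_pdivrMr// mul1r; lra.
lra.
Qed.

(** [c] is the left derivative at [s]: the supremum of the slopes of chords ending at [s], bounded
    by the slope of each chord starting there. The hypothesis [0 < s] provides chords on the
    left. *)
Lemma orlicz_support (s : R) : 0 < s ->
  exists c : R, forall t, 0 <= t -> phi s - c * s + c * t <= phi t.
Proof.
move=> s0; pose E := [set (phi s - phi t) / (s - t) | t in [set t | 0 <= t < s]].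
have Eub u : s < u -> ubound E ((phi u - phi s) / (u - s)).
  by move=> su _ [t /= /andP[t0 ts] <-]; exact: orlicz_slopes.
have E0 : E !=set0 by exists ((phi s - phi 0) / (s - 0)), 0 => //=; rewrite lexx.
exists (sup E) => t t0; have [ts|st|<-] := ltgtP t s; last by rewrite subrK.
- have : (phi s - phi t) / (s - t) <= sup E.
    apply: sup_ubound; last by exists t => //=; rewrite t0.
    by exists ((phi (s + 1) - phi s) / (s + 1 - s)); apply: Eub; rewrite ltrDl.
  by rewrite ler_pdivrMr ?subr_gt0//; lra.
- have : sup E <= (phi t - phi s) / (t - s) by apply: ge_sup => //; exact: Eub.
  by rewrite ler_pdivlMr ?subr_gt0//; lra.
Qed.

Lemma orlicz_jensen {H : hilbertType R} (A : H -> H) x : positive_operator A ->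
  nrm x = 1 -> phi (rin (A x) x) <= rin (cfc phi A x) x.
Proof.
move=> pA x1; have cphi := orlicz_continuous hphi.
have xx : rin x x = 1 by rewrite -nrm_sqr x1 expr1n.
(* The point [0] has no chords on its left; there [phi 0 = 0] and the zero minorant suffices. *)
have [_ _ /(_ x)] := pA; rewrite le_eqVlt => /predU1P[<-|s0].
  rewrite (orlicz0 hphi) (le_trans _ (cfc_lower (a := 0) (c := 0) pA cphi x _))//.
    by rewrite !mul0r addr0.
  by move=> t t0; rewrite mul0r addr0 (orlicz_ge0 hphi).
have [c hc] := orlicz_support s0.
by rewrite (le_trans _ (cfc_lower pA cphi x hc))// xx mulr1 subrK.
Qed.

(** Three nested midpoints carry the weights 1/2, 1/4, 1/8, 1/8, whose sum is 1. *)
Lemma orlicz_dyadic_mean (m X Y p q : R) : 0 <= m -> 0 <= X -> 0 <= Y -> 0 <= p ->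
  0 <= q -> m <= 2^-1 * X + 4^-1 * Y + 8^-1 * (p + q) ->
  phi m <= 2^-1 * phi X + 4^-1 * phi Y + 8^-1 * (phi p + phi q).
Proof.
move=> m0 X0 Y0 p0 q0 hm.
have half : 0 <= (2^-1 : R) <= 1 by rewrite invr_ge0 ler0n invf_le1 ?ler1n.
have mid (s t : R) : 0 <= s -> 0 <= t -> 0 <= 2^-1 * s + (1 - 2^-1) * t.
  by move=> s0 t0; lra.
have c1 := orlicz_convex hphi half p0 q0.
have c2 := orlicz_convex hphi half Y0 (mid _ _ p0 q0).
have c3 := orlicz_convex hphi half X0 (mid _ _ Y0 (mid _ _ p0 q0)).
apply: (@le_trans _ _ (phi (2^-1 * X + (1 - 2^-1) *
    (2^-1 * Y + (1 - 2^-1) * (2^-1 * p + (1 - 2^-1) * q))))); last by lra.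
by apply: (orlicz_increasing hphi) => //; lra.
Qed.

End orlicz_functions.

(** * The bound at a unit vector *)

Section pointwise_bound.
Context {R : realType} {H : hilbertType R} (T : H -> H) (phi : R -> R).
Hypotheses (bT : bounded_operator T) (hphi : orlicz phi).

Let P := absop T.
Let Q := absop (adjoint T).
Let S := cfc phi (P \o P) + cfc phi (Q \o Q).

Lemma sum_absop_bounded : bounded_operator (P + 'i *: Q).
Proof.
have [[linP [K hK]] _ _] := absop_pos bT.
have [[linQ bQ] _ _] := absop_pos (adjointP bT).1.
apply: bounded_operatorD; first by split=> //; exists K.
split; first exact: linear_scale.
case: bQ => L hL; exists L => x.
by rewrite -[('i *: Q) x]/('i *: Q x) -complexiE normrZ normc_def /= expr0n add0r expr1n
  sqrtr1 mul1r.
Qed.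

Lemma cfc_sum_bounded : bounded_operator S.
Proof.
have pP := absop_pos bT; have pQ := absop_pos (adjointP bT).1.
have cphi := orlicz_continuous hphi.
by apply: bounded_operatorD; apply: cfc_bounded => //; exact: positive_sqr.
Qed.

Lemma numerical_range_orlicz x : nrm x = 1 ->
  phi (complex.Re `|inner (T x) x| ^+ 2) <=
    2^-1 * phi (2^-1 * numerical_radius (P + 'i *: Q) ^+ 2)
  + 4^-1 * phi (numerical_radius (P \o Q)) + 8^-1 * opnorm S.
Proof.
move=> x1; have pP := absop_pos bT; have pQ := absop_pos (adjointP bT).1.
have bPQ : bounded_operator (P \o Q).
  by apply: bounded_operator_comp; [case: pP|case: pQ].
have [bP symP posP] := pP; have [bQ symQ posQ] := pQ.
pose a := rin (P x) x; pose b := rin (Q x) x.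
pose X := 2^-1 * numerical_radius (P + 'i *: Q) ^+ 2.
pose Y := numerical_radius (P \o Q).
pose p := rin (P (P x)) x; pose q := rin (Q (Q x)) x.
have a0 : 0 <= a := posP x.
have b0 : 0 <= b := posQ x.
have p0 : 0 <= p by rewrite /p symP rin_ge0.
have q0 : 0 <= q by rewrite /q symQ rin_ge0.
have Tab : complex.Re `|inner (T x) x| ^+ 2 <= a * b.
  exact: numerical_range_mixed_schwarz.
(* Both [a] and [b] are real, so [<(P + i Q) x, x> = a + i b] has squared modulus [a^2 + b^2]. *)
have abX : 2^-1 * (a ^+ 2 + b ^+ 2) <= X.
  rewrite ler_pM2l//; have h := numerical_radius_ge sum_absop_bounded x1.
  apply: le_trans (lerXn2r 2 (Re_norm_ge0 _) (numerical_radius_ge0 sum_absop_bounded) h).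
  rewrite Re_norm_sqr.
  rewrite -[(P + 'i *: Q) x]/(P x + 'i *: Q x) -complexiE Im_inner.
  rewrite -/(rin _ _).
  rewrite !rinDl rin_i (rin_rsym_i x bP.1 symP).
  rewrite -(rin_i ('i%C *: Q x)) scalerA -expr2 sqr_i scaleN1r rinNl.
  by rewrite (rin_rsym_i x bQ.1 symQ) oppr0 addr0 add0r.
have PQY : rin (P x) (Q x) <= Y.
  apply: le_trans (numerical_radius_ge bPQ x1).
  have -> : rin (P x) (Q x) = complex.Re (inner ((P \o Q) x) x).
    by rewrite symP rinC.
  rewrite (le_trans (ler_norm _))// -lecR RRe_real ?normr_real//.
  exact: normc_ge_Re.
(* Buzano's inequality, with [|P x| |Q x| <= (|P x|^2 + |Q x|^2) / 2 = (p + q) / 2]. *)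
have abY : 2 * (a * b) <= 2^-1 * (p + q) + Y.
  have := buzano (P x) (Q x) x1; rewrite -/a -/b.
  have := sqr_ge0 (nrm (P x) - nrm (Q x)).
  have : nrm (P x) ^+ 2 = p by rewrite nrm_sqr /p [RHS]symP.
  have : nrm (Q x) ^+ 2 = q by rewrite nrm_sqr /q [RHS]symQ.
  by move: PQY; lra.
have X0 : 0 <= X by rewrite mulr_ge0 ?invr_ge0 ?sqr_ge0.
have Y0 : 0 <= Y := numerical_radius_ge0 bPQ.
(* One half of [a b] is at most [X / 2], the other at most a quarter of [Y + (p + q) / 2]. *)
have ab_le : complex.Re `|inner (T x) x| ^+ 2 <= 2^-1 * X + 4^-1 * Y + 8^-1 * (p + q).
  have := sqr_ge0 (a - b); move: Tab abX abY.
  by move: (complex.Re _) (X) (Y) (p) (q) => *; lra.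
apply: (le_trans (orlicz_dyadic_mean hphi (sqr_ge0 _) X0 Y0 p0 q0 ab_le)).
rewrite lerD2l ler_pM2l ?invr_gt0//.
apply: le_trans (lerD (orlicz_jensen hphi (positive_sqr pP) x1)
  (orlicz_jensen hphi (positive_sqr pQ) x1)) _.
rewrite -rinDl (le_trans (rin_le _ _))// x1 mulr1.
by have := opnorm_bound x cfc_sum_bounded; rewrite x1 mulr1.
Qed.

End pointwise_bound.

(** * Passage to the supremum over unit vectors *)

Unset Implicit Arguments.

Theorem theorem2p20 (R : realType) (H : hilbertType R) (T : H -> H)
    (hT : bounded_operator T) (phi : R -> R) (hphi : orlicz phi) :
  phi (numerical_radius T ^+ 2) <=
    2^-1 * phi (2^-1 * numerical_radius (absop T + 'i *: absop (adjoint T)) ^+ 2)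
  + 4^-1 * phi (numerical_radius (absop T \o absop (adjoint T)))
  + 8^-1 * opnorm (cfc phi (absop T \o absop T)
                   + cfc phi (absop (adjoint T) \o absop (adjoint T))).
Proof.
have pw := numerical_range_orlicz hT hphi.
set K := (X in _ <= X) in pw *; set w := numerical_radius T.
have w0 : 0 <= w := numerical_radius_ge0 hT.
have K0 : 0 <= K.
  have [bP _ _] := absop_pos hT; have [bQ _ _] := absop_pos (adjointP hT).1.
  have phi0 t : 0 <= t -> 0 <= phi t by exact: (orlicz_ge0 hphi).
  rewrite !addr_ge0 ?mulr_ge0 ?invr_ge0//.
  - by apply: phi0; rewrite mulr_ge0 ?invr_ge0 ?sqr_ge0.
  - exact/phi0/numerical_radius_ge0/bounded_operator_comp.
  - exact/opnorm_ge0/cfc_sum_bounded.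
(* If the bound failed, continuity of [phi] at [w ^+ 2] would give a unit vector, with [r] close to
   [w], such that [phi (r ^+ 2) > K]. *)
rewrite leNgt; apply/negP => Kw.
(* The case [w = 0], which includes the zero space, is settled by [phi 0 = 0 <= K]. *)
have {}w0 : 0 < w.
  rewrite lt_def w0 andbT; apply: contraTneq Kw => ->.
  by rewrite expr0n (orlicz0 hphi) -leNgt.
have e0 : 0 < (phi (w ^+ 2) - K) / 2 by rewrite divr_gt0 ?subr_gt0.
have w2 : [set t : R | 0 <= t] (w ^+ 2) by exact: sqr_ge0.
have [d d0 hd] := within_continuousP (orlicz_continuous hphi) w2 e0.
(* From [w - r < d / (2 w)] and [r <= w] follows [w^2 - r^2 = (w - r) (w + r) < d]. *)
have [x x1 hx] := numerical_radius_approx hT w0 (divr_gt0 d0 (mulr_gt0 (ltr0n _ 2) w0)).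
have rw := numerical_radius_ge hT x1; have r0 := Re_norm_ge0 (inner (T x) x).
have : phi (complex.Re `|inner (T x) x| ^+ 2) <= K := pw x x1.
move: (complex.Re _) rw r0 hx => r rw r0 hx.
rewrite -/w in rw hx.
have : `|phi (w ^+ 2) - phi (r ^+ 2)| <= (phi (w ^+ 2) - K) / 2.
  apply: hd; first exact: sqr_ge0.
  rewrite ger0_norm ?subr_ge0 ?lerXn2r ?nnegrE ?(ltW w0)//.
  move: hx; rewrite ltrBlDr -ltrBlDl ltr_pdivlMr ?mulr_gt0//; nra.
by rewrite ler_norml => /andP[_]; lra.
Qed.
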